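(* Let $\lambda$ and $\alpha$ be real numbers with $|\lambda|<\pi/2$ and $\alpha\in[0,1)$. Let $a,b$ be complex numbers with $a+b\neq-1,-2,-3,\dots$. Then the shifted hypergeometric function $f(z)=z\,{}_2F_1(a,b;a+b+1;z)$ is $\lambda$-spirallike of order $\alpha$ if the following two conditions are satisfied: (i) $\operatorname{Re}\big[e^{-i\lambda}ab\big]>0$; (ii) $L\ge0$, $N\ge0$ and $LN-M^2\ge0$, where $$L=\operatorname{Re}\big[e^{-i\lambda}ab\,(2-\alpha+(1-\alpha)e^{-2i\lambda})\big],$$ $$M=\operatorname{Im}\big[e^{-i\lambda}ab\,(\bar a+\bar b-(1-\alpha)(1+e^{-2i\lambda}))\big],$$ $$N=\operatorname{Re}\big[e^{-i\lambda}ab\,(2\bar a+2\bar b+\alpha-(1-\alpha)e^{-2i\lambda})\big]-\frac{|a|^2|b|^2}{(1-\alpha)\cos\lambda}.$$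
   Context: $\mathbb{D}=\{z\in\mathbb{C}:|z|<1\}$. For $c\neq0,-1,-2,\dots$, the hypergeometric function is ${}_2F_1(a,b;c;z)=\sum_{n=0}^\infty\frac{(a)_n(b)_n}{(c)_n\,n!}z^n$ for $|z|<1$, where $(a)_0=1$ and $(a)_n=a(a+1)\cdots(a+n-1)$ for $n\ge1$. For real $\lambda$ with $|\lambda|<\pi/2$ and $\alpha\in[0,1)$, an analytic function $f$ on $\mathbb{D}$ with $f(0)=f'(0)-1=0$ is called $\lambda$-spirallike of order $\alpha$ if $\operatorname{Re}\left(e^{-i\lambda}\frac{zf'(z)}{f(z)}\right)>\alpha\cos\lambda$ for all $z\in\mathbb{D}$ (where $zf'(z)/f(z)$ takes the value $1$ at $z=0$). *)

(* Defs.v *)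
From Stdlib Require Import Reals Factorial.
From Coquelicot Require Import Coquelicot.

Open Scope R_scope.
Open Scope C_scope.

(* e^{it} for real t. *)
Definition expi (t : R) : C := (cos t, sin t).

(* Rising factorial (a)_n. *)
Fixpoint pochhammer (a : C) (n : nat) : C :=
  match n with
  | O => 1
  | S m => pochhammer a m * (a + INR m)
  end.

(* Coquelicot's [Series] is real-valued, so complex series are summed
   componentwise; [CSeries_correct] relates this to [is_series] over [C]. *)
Definition CSeries (u : nat -> C) : C :=
  (Series (fun n => Re (u n)), Series (fun n => Im (u n))).

Lemma CSeries_correct (u : nat -> C) (l : C) :
  is_series (K := C_AbsRing) (V := C_NormedModule) u l -> CSeries u = l.
Proof.
  intros H.
  assert (HRe : forall n, Re (sum_n (G := C_AbelianMonoid) u n)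
                          = sum_n (fun k => Re (u k)) n).
  { induction n as [|n IH].
    - now rewrite !sum_O.
    - rewrite !sum_Sn, <- IH. reflexivity. }
  assert (HIm : forall n, Im (sum_n (G := C_AbelianMonoid) u n)
                          = sum_n (fun k => Im (u k)) n).
  { induction n as [|n IH].
    - now rewrite !sum_O.
    - rewrite !sum_Sn, <- IH. reflexivity. }
  assert (Hloc : forall eps : posreal, eventually (fun n =>
            ball (l : C_R_NormedModule) eps (sum_n (G := C_AbelianMonoid) u n))).
  { intros eps. apply (H (fun y => ball (l : C_R_NormedModule) eps y)).
    now exists eps. }
  unfold CSeries. rewrite (surjective_pairing l). f_equal.
  - apply is_series_unique. intros P [eps HP].
    destruct (Hloc eps) as [N HN]. exists N. intros n Hn.
    rewrite <- HRe. apply HP, (HN n Hn).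
  - apply is_series_unique. intros P [eps HP].
    destruct (Hloc eps) as [N HN]. exists N. intros n Hn.
    rewrite <- HIm. apply HP, (HN n Hn).
Qed.

Definition hyp2F1 (a b c z : C) : C :=
  CSeries (fun n => pochhammer a n * pochhammer b n
                    / (pochhammer c n * INR (fact n)) * z ^ n).

Definition unit_disk (z : C) : Prop := (Cmod z < 1)%R.

Definition analytic_on_disk (f : C -> C) : Prop :=
  forall z, unit_disk z -> ex_derive (K := C_AbsRing) (V := C_NormedModule) f z.

(* z f'(z) / f(z), extended by its limit 1 at z = 0. *)
Definition zlogderiv (f : C -> C) (z : C) : C :=
  if Ceq_dec z 0 then 1 else z * C_derive f z / f z.

(* The fourth clause states that the quotient z f'(z) / f(z) is defined
   throughout the disk (division by zero is total on [C]). *)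
Definition spirallike (lam alpha : R) (f : C -> C) : Prop :=
  analytic_on_disk f /\
  f 0 = 0 /\
  C_derive f 0 = 1 /\
  (forall z, unit_disk z -> z <> 0 -> f z <> 0) /\
  (forall z, unit_disk z ->
     (Re (expi (- lam) * zlogderiv f z) > alpha * cos lam)%R).

(* Main.v *)
Require Import Defs.
From Stdlib Require Import Reals.
From Coquelicot Require Import Coquelicot.
From Stdlib Require Import Lra Lia Psatz Factorial ClassicalEpsilon.

(** Write F for the hypergeometric function with parameters a, b, a + b + 1,
    A = z F', T = z A' and q = A / F, so that z f' / f = 1 + q.  Being spirallike
    means that q takes its values in a half-plane, the image of the unit disk under
    w |-> k w / (1 - w) with k = 2 (1 - alpha) cos lam e^(i lam).  Solving for w gives
    w = A / Q with Q = k F + A, so the claim to prove is |A| < |Q| on the disk; it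
    contains F <> 0, because A = Q at a zero of F.

    Suppose that it fails and take a point z0 of least modulus where it does
    ([first_boundary_contact]).  Then |w| <= 1 on the disk |z| <= |z0|, with equality
    at z0, and w vanishes at 0.  By the Schwarz lemma, that is the maximum principle
    for w / z = F' / Q, the function |w / z| is largest at z0; comparing derivatives
    there ([boundary_max_derivative]) gives Jack's lemma: z w' / w is a real number
    m + 1 >= 1 at z0.

    On the other hand, for c = a + b + 1 the hypergeometric equation can be divided by
    the factor 1 - z of the first-order term and becomes
        (1 - z) (T + (a + b) A) = z a b F.
    With X = (T + (a + b) A) / F it reads X = z (X + a b), so |X| < |X + a b|, which is
    2 Re (X conj (a b)) + |a b|^2 > 0.  At z0 put q = k y.  From |w| = 1 we get
    y = (-1 + i s) / 2 with s real, and Jack's lemma expresses T, hence X, through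
    y and m.  The left-hand side is then a positive multiple of
        - (L s^2 - 2 M s + N) - m (1 + s^2) Re (e^(-i lam) a b),
    which conditions (i) and (ii) make nonpositive: a contradiction
    ([contact_identity], [boundary_contact_impossible]).

    Complex analysis enters only through term-by-term differentiation of power series
    ([cderiv_CPSeries]) and the maximum principle; since F and its derivatives are
    given as power series, second derivatives exist without Cauchy's theorem and the
    maximum principle follows from the sign of a Laplacian ([no_interior_max]). *)

Local Open Scope R_scope.

(** * Complex derivatives *)

Definition cderiv (f : C -> C) (z l : C) : Prop :=
  is_derive (K := C_AbsRing) (V := C_NormedModule) f z l.

(** The product structure on C and the one coming from the absolute-value ring have the
    same norm but are not convertible.  The product and chain rules concern the second, spirallikeness is
    stated with the first. *)
Lemma cderiv_is_derive (f : C -> C) (z l : C) :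
  cderiv f z l <->
  is_derive (K := C_AbsRing) (V := AbsRing_NormedModule C_AbsRing) f z l.
Proof.
  split; intros [_ H]; split.
  - apply is_linear_scal_l.
  - exact H.
  - apply (is_linear_scal_l (V := C_NormedModule)).
  - exact H.
Qed.

Lemma cderiv_iff (f : C -> C) (z l : C) :
  cderiv f z l <->
  (forall eps, 0 < eps -> exists delta, 0 < delta /\
     forall y, Cmod (y - z) < delta ->
       Cmod (f y - f z - (y - z) * l) <= eps * Cmod (y - z))%C.
Proof.
  split.
  - intros [_ H] eps Heps.
    destruct (H z (fun P HP => HP) (mkposreal eps Heps)) as [d Hd].
    exists d; split; [apply cond_pos|]. intros y Hy. apply (Hd y Hy).
  - intros H. split; [apply (is_linear_scal_l (V := C_NormedModule))|].
    intros x Hx. rewrite <- (is_filter_lim_locally_unique _ _ Hx).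
    intros eps. destruct (H eps (cond_pos eps)) as [d [Hd0 Hd]].
    exists (mkposreal d Hd0). intros y Hy. apply Hd, Hy.
Qed.

Lemma cderiv_ext (f g : C -> C) (z l m : C) :
  (forall x, f x = g x) -> l = m -> cderiv f z l -> cderiv g z m.
Proof. intros Hfg <- H. exact (is_derive_ext _ _ _ _ Hfg H). Qed.

Lemma cderiv_const (k z : C) : cderiv (fun _ => k) z 0.
Proof. exact (is_derive_const (K := C_AbsRing) (V := C_NormedModule) k z). Qed.

Lemma cderiv_id (z : C) : cderiv (fun y => y) z 1.
Proof. apply cderiv_is_derive. exact (is_derive_id (K := C_AbsRing) z). Qed.

Lemma cderiv_plus (f g : C -> C) (z l m : C) :
  cderiv f z l -> cderiv g z m -> cderiv (fun y => f y + g y)%C z (l + m)%C.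
Proof. intros Hf Hg. exact (is_derive_plus _ _ _ _ _ Hf Hg). Qed.

Lemma cderiv_opp (f : C -> C) (z l : C) :
  cderiv f z l -> cderiv (fun y => - f y)%C z (- l)%C.
Proof. intros Hf. exact (is_derive_opp _ _ _ Hf). Qed.

Lemma cderiv_mult (f g : C -> C) (z l m : C) :
  cderiv f z l -> cderiv g z m ->
  cderiv (fun y => f y * g y)%C z (l * g z + f z * m)%C.
Proof.
  rewrite !cderiv_is_derive. intros Hf Hg.
  exact (is_derive_mult (K := C_AbsRing) _ _ _ _ _ Hf Hg Cmult_comm).
Qed.

Lemma cderiv_continuous (f : C -> C) (z l : C) : cderiv f z l ->
  forall eps, 0 < eps -> exists delta, 0 < delta /\
    forall y, Cmod (y - z) < delta -> Cmod (f y - f z) < eps.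
Proof.
  intros H eps Heps. destruct (proj1 (cderiv_iff _ _ _) H 1 Rlt_0_1) as [d [Hd0 Hd]].
  assert (Hl := Cmod_ge_0 l).
  assert (He : 0 < eps / (2 + Cmod l)) by (apply Rdiv_lt_0_compat; lra).
  exists (Rmin d (eps / (2 + Cmod l))). split; [now apply Rmin_glb_lt|].
  intros y Hy. specialize (Hd y (Rlt_le_trans _ _ _ Hy (Rmin_l _ _))).
  replace (f y - f z)%C with ((f y - f z - (y - z) * l) + (y - z) * l)%C by ring.
  eapply Rle_lt_trans; [apply Cmod_triangle|]. rewrite Cmod_mult.
  assert (Hy2 := Rlt_le_trans _ _ _ Hy (Rmin_r _ _)).
  assert (H0 := Cmod_ge_0 (y - z)).
  assert (Cmod (y - z) * (2 + Cmod l) < eps).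
  { apply (Rmult_lt_compat_r (2 + Cmod l)) in Hy2; [|lra].
    unfold Rdiv in Hy2. rewrite Rmult_assoc, Rinv_l in Hy2; lra. }
  nra.
Qed.

Lemma cderiv_inv (f : C -> C) (z l : C) :
  cderiv f z l -> f z <> 0%C -> cderiv (fun y => / f y)%C z (- l / (f z * f z))%C.
Proof.
  intros Hf Hz.
  assert (Hinv : forall w : C, w <> 0%C -> cderiv (fun y => / y)%C w (- / (w * w))%C).
  { intros w Hw. apply cderiv_iff. intros eps Heps.
    assert (Hw0 : 0 < Cmod w) by now apply Cmod_gt_0.
    set (m := Cmod w) in *.
    assert (Hd : 0 < eps * m ^ 3 / 2).
    { apply Rdiv_lt_0_compat; [|lra]. apply Rmult_lt_0_compat; [lra|]. now apply pow_lt. }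
    exists (Rmin (m / 2) (eps * m ^ 3 / 2)). split; [apply Rmin_glb_lt; lra|].
    intros y Hy.
    assert (H1 := Rlt_le_trans _ _ _ Hy (Rmin_l _ _)).
    assert (H2 := Rlt_le_trans _ _ _ Hy (Rmin_r _ _)).
    assert (Hym : m / 2 < Cmod y).
    { assert (H3 := Cmod_triangle y (w - y)). replace (y + (w - y))%C with w in H3 by ring.
      replace (w - y)%C with (- (y - w))%C in H3 by ring. rewrite Cmod_opp in H3.
      fold m in H3. lra. }
    assert (Hy0 : y <> 0%C) by (apply Cmod_gt_0; lra).
    replace (/ y - / w - (y - w) * - / (w * w))%C
      with ((y - w) * ((y - w) * / (y * (w * w))))%C.
    2:{ field. now split. }
    rewrite Cmod_mult, Rmult_comm. apply Rmult_le_compat_r; [apply Cmod_ge_0|].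
    rewrite Cmod_mult, Cmod_inv, !Cmod_mult by (repeat apply Cmult_neq_0; assumption).
    fold m. apply Rle_div_l; [apply Rmult_lt_0_compat; nra|].
    assert (m ^ 3 / 2 <= Cmod y * (m * m)) by nra.
    nra. }
  apply cderiv_is_derive.
  apply (proj1 (cderiv_is_derive _ _ _)) in Hf.
  assert (H := is_derive_comp (K := C_AbsRing) (V := C_NormedModule) Cinv f z _ _
                (Hinv _ Hz) Hf).
  apply cderiv_is_derive. refine (cderiv_ext _ _ _ _ _ (fun x => eq_refl) _ H).
  change (l * - / (f z * f z) = - l / (f z * f z))%C. unfold Cdiv. ring.
Qed.

Lemma Rabs_Im_le_Cmod (z : C) : Rabs (Im z) <= Cmod z.
Proof. apply (Rle_trans _ (Rmax (Rabs (fst z)) (Rabs (snd z)))); [apply Rmax_r | apply Rmax_Cmod]. Qed.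

(** Restricting a holomorphic function to a real line reduces the arguments about
    extrema of moduli below to one real variable. *)
Lemma is_derive_line (f : C -> C) (z e l : C) (t : R) (p : C -> R) :
  p = Re \/ p = Im ->
  cderiv f (z + t * e)%C l ->
  is_derive (fun s : R => p (f (z + s * e)%C)) t (p (e * l)%C).
Proof.
  intros Hp Hf.
  assert (Hlin : forall x y : C, p (x - y)%C = p x - p y).
  { intros x y. now destruct Hp; subst p. }
  assert (Hscal : forall (r : R) (x : C), p (r * x)%C = r * p x).
  { intros r x. destruct Hp; subst p; [apply re_scal_l | apply im_scal_l]. }
  assert (Hle : forall x : C, Rabs (p x) <= Cmod x).
  { intros x. destruct Hp; subst p; [apply re_le_Cmod | apply Rabs_Im_le_Cmod]. }
  split; [apply is_linear_scal_l|].
  intros x Hx. rewrite <- (is_filter_lim_locally_unique _ _ Hx). clear x Hx.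
  intros eps. assert (He := Cmod_ge_0 e).
  assert (Heps : 0 < eps / (1 + Cmod e)).
  { apply Rdiv_lt_0_compat; [apply cond_pos | lra]. }
  destruct (proj1 (cderiv_iff _ _ _) Hf _ Heps) as [d [Hd0 Hd]].
  assert (Hd1 : 0 < d / (1 + Cmod e)) by (apply Rdiv_lt_0_compat; lra).
  exists (mkposreal _ Hd1). intros s Hs.
  change (Rabs (s - t) < d / (1 + Cmod e)) in Hs.
  change (Rabs (p (f (z + s * e)%C) - p (f (z + t * e)%C) - (s - t) * p (e * l)%C)
            <= eps * Rabs (s - t)).
  rewrite <- Hlin, <- Hscal, <- Hlin.
  assert (Hst : (z + s * e - (z + t * e) = RtoC (s - t) * e)%C).
  { rewrite RtoC_minus. ring. }
  specialize (Hd (z + s * e)%C). rewrite Hst, Cmod_mult, Cmod_R in Hd.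
  apply Rlt_div_r in Hs; [|lra].
  assert (Hs0 := Rabs_pos (s - t)).
  eapply Rle_trans; [apply Hle|].
  replace (RtoC (s - t) * (e * l))%C with (RtoC (s - t) * e * l)%C by ring.
  eapply Rle_trans; [apply Hd; nra|].
  apply Rle_trans with (eps / (1 + Cmod e) * (Rabs (s - t) * (1 + Cmod e))).
  { apply Rmult_le_compat_l; [lra|]. nra. }
  right. field. lra.
Qed.

(** The real inner product of the plane R^2 = C. *)
Definition Cdot (x y : C) : R := Re (Cconj x * y).

Lemma is_derive_Cmod2_line (f : C -> C) (z e l : C) (t : R) :
  cderiv f (z + t * e)%C l ->
  is_derive (fun s : R => Cmod (f (z + s * e)%C) ^ 2) t
    (2 * Cdot (f (z + t * e)%C) (e * l)).
Proof.
  intros Hf.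
  assert (H1 := is_derive_line f z e l t Re (or_introl eq_refl) Hf).
  assert (H2 := is_derive_line f z e l t Im (or_intror eq_refl) Hf).
  apply is_derive_ext with
    (fun s : R => Re (f (z + s * e)%C) ^ 2 + Im (f (z + s * e)%C) ^ 2).
  { intros s. now rewrite Cmod2_alt. }
  unfold Cdot. rewrite re_mult, re_conj, im_conj.
  evar_last.
  - apply (is_derive_plus (K := R_AbsRing) (V := R_NormedModule));
      apply is_derive_pow; eassumption.
  - unfold plus; simpl. ring.
Qed.

Lemma is_derive_Cdot_line (f g : C -> C) (z e l m : C) (t : R) :
  cderiv f (z + t * e)%C l -> cderiv g (z + t * e)%C m ->
  is_derive (fun s : R => Cdot (f (z + s * e)%C) (e * g (z + s * e)%C)) t
    (Cdot (e * l) (e * g (z + t * e)%C) + Cdot (f (z + t * e)%C) (e * (e * m))).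
Proof.
  intros Hf Hg.
  assert (H1 := is_derive_line f z e l t Re (or_introl eq_refl) Hf).
  assert (H2 := is_derive_line f z e l t Im (or_intror eq_refl) Hf).
  assert (Hg' : cderiv (fun y => e * g y)%C (z + t * e)%C (e * m)%C).
  { refine (cderiv_ext _ _ _ _ _ (fun x => eq_refl) _
             (cderiv_mult _ _ _ _ _ (cderiv_const e _) Hg)). ring. }
  assert (H3 := is_derive_line _ z e _ t Re (or_introl eq_refl) Hg').
  assert (H4 := is_derive_line _ z e _ t Im (or_intror eq_refl) Hg').
  cbv beta in H3, H4.
  apply is_derive_ext with
    (fun s : R => Re (f (z + s * e)%C) * Re (e * g (z + s * e))%C
                + Im (f (z + s * e)%C) * Im (e * g (z + s * e))%C).
  { intros s. unfold Cdot. rewrite (re_mult (Cconj _)), re_conj, im_conj. simpl. ring. }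
  unfold Cdot.
  rewrite (re_mult (Cconj (e * l))), (re_mult (Cconj (f _))), !re_conj, !im_conj.
  evar_last.
  - apply (is_derive_plus (K := R_AbsRing) (V := R_NormedModule));
      apply (is_derive_mult (K := R_AbsRing)); try eassumption;
      exact Rmult_comm.
  - unfold plus, mult; simpl. ring.
Qed.

(** * The maximum principle and derivatives at a boundary maximum *)

(** The local bounds and neighbourhoods are encoded in a single gauge delta, with 1 / delta
    as the bound, so that the lower bound for delta on a finite cover of a square bounds
    the function. *)
Lemma bounded_on_compact (D : C -> Prop) (f : C -> R) (r : R) :
  (forall z, D z -> Cmod z <= r) ->
  (forall u : C, exists delta B, 0 < delta /\
     forall z, D z -> Cmod (z - u)%C < delta -> f z <= B) ->
  exists M, forall z, D z -> f z <= M.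
Proof.
  intros HD Hloc.
  assert (Hd : forall x y : R, exists delta : posreal,
            forall z : C, D z -> Cmod (z - (x, y))%C < 2 * delta -> f z <= / delta).
  { intros x y. destruct (Hloc (x, y)) as [d [B [Hd HB]]].
    assert (HB0 := Rabs_pos B).
    assert (Hm : 0 < Rmin (d / 2) (/ (1 + Rabs B))).
    { apply Rmin_glb_lt; [lra|]. apply Rinv_0_lt_compat; lra. }
    exists (mkposreal _ Hm). simpl. intros z Hz Hzu.
    apply Rle_trans with B.
    - apply HB; [exact Hz|]. assert (H := Rmin_l (d / 2) (/ (1 + Rabs B))). lra.
    - apply Rle_trans with (1 + Rabs B); [assert (H := Rle_abs B); lra|].
      rewrite <- (Rinv_inv (1 + Rabs B)) at 1. apply Rinv_le_contravar; [exact Hm | apply Rmin_r]. }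
  pose (delta := fun x y => proj1_sig (constructive_indefinite_description _ (Hd x y))).
  assert (Hdelta : forall x y (z : C), D z -> Cmod (z - (x, y))%C < 2 * delta x y ->
            f z <= / delta x y).
  { intros x y. exact (proj2_sig (constructive_indefinite_description _ (Hd x y))). }
  destruct (compactness_value_2d (- r) r (- r) r delta) as [d Hcov].
  exists (/ d). intros z Hz. apply Rnot_lt_le. intros Hlt.
  assert (Hzr := HD z Hz).
  assert (Hre := re_le_Cmod z). assert (Him := Rabs_Im_le_Cmod z).
  apply (Hcov (Re z) (Im z)).
  { apply Rabs_le_between. lra. }
  { apply Rabs_le_between. lra. }
  intros [x [y [_ [_ [Hx [Hy Hdle]]]]]].
  apply (Rlt_not_le _ _ Hlt). apply Rle_trans with (/ delta x y).
  - apply Hdelta; [exact Hz|].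
    apply Rle_lt_trans with (sqrt 2 * Rmax (Rabs (Re z - x)) (Rabs (Im z - y))).
    { apply (Cmod_2Rmax (z - (x, y))%C). }
    assert (H2 : sqrt 2 < 2).
    { rewrite <- (sqrt_Rsqr 2) at 2 by lra. apply sqrt_lt_1; unfold Rsqr; lra. }
    assert (Hm : Rmax (Rabs (Re z - x)) (Rabs (Im z - y)) < delta x y)
      by now apply Rmax_lub_lt.
    assert (H0 := sqrt_pos 2). assert (Hp := cond_pos (delta x y)).
    assert (Hm0 := Rle_trans _ _ _ (Rabs_pos _) (Rmax_l (Rabs (Re z - x)) (Rabs (Im z - y)))).
    nra.
  - apply Rinv_le_contravar; [apply cond_pos | exact Hdle].
Qed.

(** Upper semicontinuity suffices: if the supremum S were not attained, 1 / (S - f) would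
    be locally bounded on the compact set D, hence bounded. *)
Lemma max_on_compact (D : C -> Prop) (f : C -> R) (r : R) :
  (forall z, D z -> Cmod z <= r) ->
  (forall u, ~ D u -> exists delta, 0 < delta /\
     forall z, Cmod (z - u)%C < delta -> ~ D z) ->
  (forall u, D u -> forall eps, 0 < eps -> exists delta, 0 < delta /\
     forall z, D z -> Cmod (z - u)%C < delta -> f z < f u + eps) ->
  (exists z, D z) ->
  exists z0, D z0 /\ forall z, D z -> f z <= f z0.
Proof.
  intros HD Hcl Husc [w Hw].
  assert (Hbd : forall g : C -> R,
    (forall u, D u -> exists delta B, 0 < delta /\
       forall z, D z -> Cmod (z - u)%C < delta -> g z <= B) ->
    exists M, forall z, D z -> g z <= M).
  { intros g Hg. apply (bounded_on_compact D g r HD). intros u.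
    destruct (excluded_middle_informative (D u)) as [Hu|Hu]; [now apply Hg|].
    destruct (Hcl u Hu) as [d [Hd0 Hd]]. exists d, 0. split; [exact Hd0|].
    intros z Hz Hzu. now destruct (Hd z Hzu). }
  destruct (Hbd f) as [M HM].
  { intros u Hu. destruct (Husc u Hu 1 Rlt_0_1) as [d [Hd0 Hd]].
    exists d, (f u + 1). split; [exact Hd0|]. intros z Hz Hzu. now apply Rlt_le, Hd. }
  destruct (completeness (fun x => exists z, D z /\ x = f z)) as [S [HS1 HS2]].
  { exists M. intros x [z [Hz ->]]. now apply HM. }
  { exists (f w). now exists w. }
  apply NNPP. intros Hno.
  assert (Hlt : forall z, D z -> f z < S).
  { intros z Hz. destruct (Rle_lt_or_eq_dec (f z) S) as [H|H]; [|exact H|].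
    - apply HS1. now exists z.
    - exfalso. apply Hno. exists z. split; [exact Hz|]. intros y Hy. rewrite H.
      apply HS1. now exists y. }
  destruct (Hbd (fun z => / (S - f z))) as [B HB].
  { intros u Hu. assert (Hu1 := Hlt u Hu).
    destruct (Husc u Hu ((S - f u) / 2)) as [d [Hd0 Hd]]; [lra|].
    exists d, (/ ((S - f u) / 2)). split; [exact Hd0|]. intros z Hz Hzu.
    specialize (Hd z Hz Hzu). apply Rinv_le_contravar; lra. }
  assert (HB0 : 0 < B).
  { apply Rlt_le_trans with (/ (S - f w)); [|now apply HB].
    apply Rinv_0_lt_compat. specialize (Hlt w Hw). lra. }
  assert (HS3 : S <= S - / B).
  { apply HS2. intros x [z [Hz ->]].
    assert (H := HB z Hz). assert (H1 := Hlt z Hz).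
    assert (/ B <= S - f z); [|lra].
    rewrite <- (Rinv_inv (S - f z)). apply Rinv_le_contravar; [|exact H].
    apply Rinv_0_lt_compat. lra. }
  assert (0 < / B) by now apply Rinv_0_lt_compat. lra.
Qed.

Lemma second_derivative_at_max (p p1 : R -> R) (p2 d : R) :
  0 < d ->
  (forall t, Rabs t < d -> is_derive p t (p1 t)) ->
  is_derive p1 0 p2 ->
  (forall t, Rabs t < d -> p t <= p 0) ->
  p2 <= 0.
Proof.
  intros Hd Hp Hp1 Hmax.
  assert (H0 : p1 0 = 0).
  { assert (Hd0 : Rabs 0 < d) by (rewrite Rabs_R0; exact Hd).
    assert (pr : derivable_pt p 0).
    { exists (p1 0). now apply is_derive_Reals, Hp. }
    rewrite <- (is_derive_unique _ _ _ (Hp 0 Hd0)).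
    rewrite <- (Derive_Reals p 0 pr).
    apply (deriv_maximum p (- d) d 0 pr); try lra.
    intros x Hx1 Hx2. apply Hmax. apply Rabs_lt_between. lra. }
  apply Rnot_lt_le. intros Hlt.
  (* a positive second derivative makes [p1] positive just to the right of 0 *)
  apply is_derive_Reals in Hp1.
  destruct (Hp1 (p2 / 2)) as [e He]; [lra|].
  assert (He0 := cond_pos e).
  pose (t := Rmin (d / 2) (e / 2)).
  assert (Ht : 0 < t) by (apply Rmin_glb_lt; lra).
  assert (Htd : t < d) by (assert (H := Rmin_l (d / 2) (e / 2)); unfold t; lra).
  assert (Hte : t < e) by (assert (H := Rmin_r (d / 2) (e / 2)); unfold t; lra).
  assert (Hpos : forall s, 0 < s <= t -> 0 < p1 s).
  { intros s Hs. assert (H := He s ltac:(lra)).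
    rewrite Rplus_0_l, H0 in H. rewrite Rabs_right in H by lra.
    specialize (H ltac:(lra)). apply Rabs_lt_between in H.
    assert (H1 : p2 / 2 < (p1 s - 0) / s) by lra.
    apply Rlt_div_r in H1; [|lra]. nra. }
  destruct (MVT_cor2 p p1 0 t Ht) as [s [Hs1 Hs2]].
  { intros c Hc. apply is_derive_Reals, Hp. apply Rabs_lt_between. lra. }
  specialize (Hpos s ltac:(lra)).
  assert (H := Hmax t ltac:(apply Rabs_lt_between; lra)). nra.
Qed.

Lemma Cdot_self (x : C) : Cdot x x = Cmod x ^ 2.
Proof. rewrite Cmod2_alt. unfold Cdot. rewrite re_mult, re_conj, im_conj. ring. Qed.

(** The Laplacian of |h|^2 + eps |z|^2 is 4 |h'|^2 + 4 eps > 0, whereas at a local maximum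
    its second derivatives in the directions 1 and i are both nonpositive. *)
Lemma no_interior_max (h h1 : C -> C) (h2 z : C) (eps d : R) :
  0 < eps -> 0 < d ->
  (forall y, Cmod (y - z)%C < d -> cderiv h y (h1 y)) ->
  cderiv h1 z h2 ->
  (forall y, Cmod (y - z)%C < d ->
     Cmod (h y) ^ 2 + eps * Cmod y ^ 2 <= Cmod (h z) ^ 2 + eps * Cmod z ^ 2) ->
  False.
Proof.
  intros Heps Hd Hh Hh1 Hmax.
  assert (Hdir : forall e : C, Cmod e = 1 ->
    2 * (Cdot (e * h1 z) (e * h1 z) + Cdot (h z) (e * (e * h2))) + eps * 2 <= 0).
  { intros e He.
    assert (Hline : forall t : R, Cmod (z + t * e - z)%C = Rabs t).
    { intros t. replace (z + t * e - z)%C with (t * e)%C by ring.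
      now rewrite Cmod_mult, Cmod_R, He, Rmult_1_r. }
    assert (Hz0 : (z + 0%R * e)%C = z) by ring.
    apply (second_derivative_at_max
      (fun t => Cmod (h (z + t * e)%C) ^ 2 + eps * Cmod (z + t * e)%C ^ 2)
      (fun t => 2 * Cdot (h (z + t * e)%C) (e * h1 (z + t * e)%C)
                + eps * (2 * Cdot (z + t * e)%C (e * 1))) _ d Hd).
    - intros t Ht. apply (is_derive_plus (K := R_AbsRing) (V := R_NormedModule)).
      + apply is_derive_Cmod2_line. apply Hh. now rewrite Hline.
      + apply (is_derive_scal (fun s : R => Cmod (z + s * e)%C ^ 2)).
        exact (is_derive_Cmod2_line (fun y => y) z e 1 t (cderiv_id _)).
    - evar_last.
      + apply (is_derive_plus (K := R_AbsRing) (V := R_NormedModule)).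
        * apply (is_derive_scal (fun s : R => Cdot (h (z + s * e)%C) (e * h1 (z + s * e)%C))).
          apply (is_derive_Cdot_line h h1 z e (h1 z) h2 0); rewrite Hz0.
          -- apply Hh. replace (z - z)%C with (RtoC 0) by ring. now rewrite Cmod_0.
          -- exact Hh1.
        * apply is_derive_scal.
          apply (is_derive_scal (fun s : R => Cdot (z + s * e)%C (e * 1)%C)).
          exact (is_derive_Cdot_line (fun y => y) (fun _ => RtoC 1) z e 1 0 0
                   (cderiv_id _) (cderiv_const _ _)).
      + rewrite Hz0. unfold plus; simpl.
        replace (e * 1)%C with e by ring. replace (e * (e * 0))%C with (RtoC 0) by ring.
        assert (Hee : Cdot e e = 1) by (rewrite Cdot_self, He; ring).
        rewrite Hee. assert (Hz1 : Cdot z 0 = 0) by (unfold Cdot; rewrite re_mult; simpl; ring).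
        rewrite Hz1. ring.
    - intros t Ht. rewrite Hz0. apply Hmax. now rewrite Hline. }
  (* the terms in h'' for the directions 1 and i cancel, since i^2 = -1 *)
  assert (H1 := Hdir 1%C Cmod_1). assert (H2 := Hdir Ci Cmod_Ci).
  rewrite !Cdot_self, !Cmod_mult, Cmod_1 in H1.
  rewrite !Cdot_self, !Cmod_mult, Cmod_Ci in H2.
  assert (Hsum : Cdot (h z) (Ci * (Ci * h2)) = - Cdot (h z) (1 * (1 * h2))).
  { unfold Cdot, Ci. destruct (h z), h2. simpl. ring. }
  assert (H := pow2_ge_0 (Cmod (h1 z))). nra.
Qed.

(** The perturbation eps |z|^2 of [no_interior_max] forces the maximum onto the circle and
    costs at most eps r^2; eps tends to 0. *)
Lemma maximum_principle (h h1 : C -> C) (r B : R) :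
  (forall z, Cmod z <= r -> cderiv h z (h1 z)) ->
  (forall z, Cmod z <= r -> exists l, cderiv h1 z l) ->
  (forall z, Cmod z = r -> Cmod (h z) <= B) ->
  forall z, Cmod z <= r -> Cmod (h z) <= B.
Proof.
  intros Hh Hh1 HB z Hz.
  assert (Hz0 := Cmod_ge_0 z).
  assert (Hr : 0 <= r) by lra.
  assert (HB0 : 0 <= B).
  { assert (Hrr : Cmod (RtoC r) = r) by (rewrite Cmod_R; apply Rabs_right; lra).
    apply Rle_trans with (Cmod (h r)); [apply Cmod_ge_0 | now apply HB]. }
  assert (Hsq : forall eps, 0 < eps -> Cmod (h z) ^ 2 <= B ^ 2 + eps * r ^ 2).
  { intros eps Heps.
    destruct (max_on_compact (fun y => Cmod y <= r)
                (fun y => Cmod (h y) ^ 2 + eps * Cmod y ^ 2) r) as [y0 [Hy0 Hmax]].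
    - tauto.
    - intros u Hu. exists (Cmod u - r). split; [lra|]. intros y Hy Hyr.
      assert (H := Cmod_triangle (- (y - u)) y). rewrite Cmod_opp in H.
      replace (- (y - u) + y)%C with u in H by ring. lra.
    - (* continuity of |h|^2 + eps |z|^2, with an explicit modulus *)
      intros u Hu e He.
      assert (Hu0 := Cmod_ge_0 u). assert (Hhu := Cmod_ge_0 (h u)).
      set (K := 2 * Cmod (h u) + 1 + eps * (2 * Cmod u + 1)).
      assert (HK : 0 < K) by (unfold K; nra).
      assert (HeK : 0 < Rmin 1 (e / K)).
      { apply Rmin_glb_lt; [lra|]. now apply Rdiv_lt_0_compat. }
      destruct (cderiv_continuous h u _ (Hh u Hu) _ HeK) as [d [Hd0 Hd]].
      exists (Rmin d (Rmin 1 (e / K))). split; [now apply Rmin_glb_lt|].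
      intros y _ Hy.
      specialize (Hd y (Rlt_le_trans _ _ _ Hy (Rmin_l _ _))).
      assert (Hy' := Rlt_le_trans _ _ _ Hy (Rmin_r _ _)).
      set (m := Rmin 1 (e / K)) in *.
      assert (Hm1 : m <= 1) by apply Rmin_l.
      assert (Hm2 : m * K <= e).
      { apply Rle_div_r; [exact HK | apply Rmin_r]. }
      assert (Hstep : forall p q : C, Cmod (p - q)%C < m ->
                Cmod p ^ 2 <= Cmod q ^ 2 + m * (2 * Cmod q + 1)).
      { intros p q Hpq. assert (Ht := Cmod_triangle (p - q) q).
        replace (p - q + q)%C with p in Ht by ring.
        assert (H1 := Cmod_ge_0 p). assert (H2 := Cmod_ge_0 q).
        assert (Cmod p <= Cmod q + m) by lra. nra. }
      assert (Hlt : Cmod (h y) ^ 2 < Cmod (h u) ^ 2 + m * (2 * Cmod (h u) + 1)).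
      { assert (Ht := Cmod_triangle (h y - h u) (h u)).
        replace (h y - h u + h u)%C with (h y) in Ht by ring.
        assert (H1 := Cmod_ge_0 (h y)). nra. }
      assert (H3 := Hstep y u Hy').
      assert (H4 : eps * Cmod y ^ 2 <= eps * (Cmod u ^ 2 + m * (2 * Cmod u + 1)))
        by (apply Rmult_le_compat_l; lra).
      unfold K in Hm2. lra.
    - now exists z.
    - specialize (Hmax z Hz) as Hmz.
      assert (Hez : 0 <= eps * Cmod z ^ 2).
      { apply Rmult_le_pos; [lra | apply pow2_ge_0]. }
      destruct (Rle_lt_or_eq_dec _ _ Hy0) as [Hlt|Heq].
      + exfalso. destruct (Hh1 y0 Hy0) as [h2 Hh2].
        apply (no_interior_max h h1 h2 y0 eps (r - Cmod y0)); try lra.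
        * intros y Hy. apply Hh. assert (H := Cmod_triangle (y - y0) y0).
          replace (y - y0 + y0)%C with y in H by ring. lra.
        * exact Hh2.
        * intros y Hy. apply Hmax. assert (H := Cmod_triangle (y - y0) y0).
          replace (y - y0 + y0)%C with y in H by ring. lra.
      + rewrite Heq in Hmz. assert (H := HB y0 Heq).
        assert (H0 := Cmod_ge_0 (h y0)). nra. }
  apply Rnot_lt_le. intros Hlt.
  assert (Hr2 := pow2_ge_0 r).
  assert (He : 0 < (Cmod (h z) ^ 2 - B ^ 2) / (2 * (1 + r ^ 2))).
  { apply Rdiv_lt_0_compat; [nra | lra]. }
  assert (H := Hsq _ He).
  assert (Hm : (Cmod (h z) ^ 2 - B ^ 2) / (2 * (1 + r ^ 2)) * (1 + r ^ 2)
               = (Cmod (h z) ^ 2 - B ^ 2) / 2) by (field; lra).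
  nra.
Qed.

Lemma derive_nonpos_of_right_max (p : R -> R) (l d : R) :
  0 < d -> is_derive p 0 l -> (forall t, 0 < t < d -> p t <= p 0) -> l <= 0.
Proof.
  intros Hd Hp Hle. apply Rnot_lt_le. intros Hl.
  apply is_derive_Reals in Hp. destruct (Hp (l / 2)) as [e He]; [lra|].
  assert (He0 := cond_pos e).
  pose (t := Rmin (d / 2) (e / 2)).
  assert (Ht : 0 < t) by (apply Rmin_glb_lt; lra).
  assert (Htd : t < d) by (assert (H := Rmin_l (d / 2) (e / 2)); unfold t; lra).
  assert (Hte : t < e) by (assert (H := Rmin_r (d / 2) (e / 2)); unfold t; lra).
  assert (H := He t ltac:(lra)). rewrite Rplus_0_l in H.
  rewrite Rabs_right in H by lra. specialize (H ltac:(lra)).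
  apply Rabs_lt_between in H. assert (H1 : l / 2 < (p t - p 0) / t) by lra.
  apply Rlt_div_r in H1; [|lra]. specialize (Hle t ltac:(lra)). nra.
Qed.

(** By the maximum principle |g| <= |g z0| on the whole disk.  Hence Re (mu zeta) <= 0 for
    mu = conj (g z0) z0 g'(z0) and every zeta with Re zeta < 0, as z0 + t z0 zeta is in
    the disk for small t > 0; so mu is a nonnegative real number.  For w = z g this says
    that z w' / w is real and at least 1 at z0, which is Jack's lemma. *)
Lemma boundary_max_derivative (g g1 : C -> C) (r : R) (z0 : C) :
  0 < r ->
  (forall z, Cmod z <= r -> cderiv g z (g1 z)) ->
  (forall z, Cmod z <= r -> exists l, cderiv g1 z l) ->
  Cmod z0 = r ->
  (forall z, Cmod z = r -> Cmod (g z) <= Cmod (g z0)) ->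
  g z0 <> 0%C ->
  exists m : R, 0 <= m /\ (z0 * g1 z0 = m * g z0)%C.
Proof.
  intros Hr Hg Hg1 Hz0 Hcirc Hgz.
  assert (Hmax := maximum_principle g g1 r _ Hg Hg1 Hcirc).
  set (mu := (Cconj (g z0) * (z0 * g1 z0))%C).
  (* zeta = -1 + i y; the point z0 (1 + t zeta) is in the disk for t < 2 / (1 + y^2) *)
  assert (Hin : forall y : R, - Re mu - y * Im mu <= 0).
  { intros y. pose (zeta := ((-1, y) : C)).
    assert (Hzero : (z0 + 0%R * (z0 * zeta))%C = z0) by ring.
    assert (Hd : is_derive (fun s : R => Cmod (g (z0 + s * (z0 * zeta))%C) ^ 2) 0
                   (2 * (- Re mu - y * Im mu))).
    { evar_last.
      - apply (is_derive_Cmod2_line g z0 (z0 * zeta) (g1 z0) 0). rewrite Hzero.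
        apply Hg. lra.
      - rewrite Hzero. unfold Cdot.
        replace (Cconj (g z0) * (z0 * zeta * g1 z0))%C with (mu * zeta)%C
          by (unfold mu; ring).
        rewrite re_mult. unfold zeta. simpl. ring. }
    assert (Hy2 := pow2_ge_0 y).
    assert (Hdpos : 0 < 2 / (1 + y ^ 2)) by (apply Rdiv_lt_0_compat; lra).
    assert (H := derive_nonpos_of_right_max _ _ _ Hdpos Hd).
    enough (2 * (- Re mu - y * Im mu) <= 0) by lra.
    apply H. intros t Ht. rewrite Hzero.
    assert (Hle : Cmod (g (z0 + t * (z0 * zeta))%C) <= Cmod (g z0)).
    { apply Hmax.
      replace (z0 + t * (z0 * zeta))%C with (z0 * (1 + t * zeta))%C by ring.
      rewrite Cmod_mult, Hz0.
      assert (Hc : Cmod (1 + t * zeta)%C <= 1).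
      { apply Rsqr_incr_0_var; [|lra]. rewrite !Rsqr_pow2, Cmod2_alt.
        unfold zeta. simpl.
        assert (Ht2 : t * (1 + y ^ 2) < 2) by (apply Rlt_div_r; lra). nra. }
      assert (Hc0 := Cmod_ge_0 (1 + t * zeta)%C). nra. }
    assert (H1 := Cmod_ge_0 (g (z0 + t * (z0 * zeta))%C)). nra. }
  assert (Him : Im mu = 0).
  { destruct (Req_dec (Im mu) 0) as [H|H]; [exact H|].
    assert (H2 := Hin (- (Re mu + 1) / Im mu)).
    replace (- (Re mu + 1) / Im mu * Im mu) with (- (Re mu + 1)) in H2 by (field; exact H).
    lra. }
  assert (Hre : 0 <= Re mu) by (assert (H := Hin 0); lra).
  assert (Hm : 0 < Cmod (g z0)) by now apply Cmod_gt_0.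
  exists (Re mu / Cmod (g z0) ^ 2). split.
  { apply Rdiv_le_0_compat; [exact Hre | now apply pow_lt]. }
  assert (Hmu : RtoC (Re mu) = mu).
  { rewrite (surjective_pairing mu). unfold RtoC, Re. simpl. now rewrite <- Him. }
  assert (Hconj : Cconj (g z0) <> 0%C).
  { apply Cmod_gt_0. now rewrite Cmod_conj. }
  rewrite RtoC_div by (apply pow_nonzero; lra). rewrite Hmu, Cmod2_conj.
  unfold mu. field. now split.
Qed.

(** * Complex power series on the unit disk *)

Definition abs_summable (u : nat -> C) : Prop := ex_series (fun n => Cmod (u n)).

Lemma abs_summable_le (u : nat -> C) (v : nat -> R) :
  (forall n, Cmod (u n) <= v n) -> ex_series v -> abs_summable u.
Proof.
  intros Huv Hv. apply (ex_series_le (V := R_CompleteNormedModule) _ v); [|exact Hv].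
  intros n. change (Rabs (Cmod (u n)) <= v n).
  rewrite Rabs_right; [apply Huv | apply Rle_ge, Cmod_ge_0].
Qed.

Lemma ex_series_Rabs_part (u : nat -> C) (p : C -> R) :
  p = Re \/ p = Im -> abs_summable u -> ex_series (fun n => Rabs (p (u n))).
Proof.
  intros Hp Hu.
  apply (ex_series_le (V := R_CompleteNormedModule) _ (fun n => Cmod (u n))); [|exact Hu].
  intros n. change (Rabs (Rabs (p (u n))) <= Cmod (u n)). rewrite Rabs_Rabsolu.
  destruct Hp; subst p; [apply re_le_Cmod | apply Rabs_Im_le_Cmod].
Qed.

Lemma ex_series_part (u : nat -> C) (p : C -> R) :
  p = Re \/ p = Im -> abs_summable u -> ex_series (fun n => p (u n)).
Proof. intros Hp Hu. now apply ex_series_Rabs, (ex_series_Rabs_part u p). Qed.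

Lemma abs_summable_plus (u v : nat -> C) :
  abs_summable u -> abs_summable v -> abs_summable (fun n => u n + v n)%C.
Proof.
  intros Hu Hv. apply (abs_summable_le _ (fun n => Cmod (u n) + Cmod (v n))).
  - intros n. apply Cmod_triangle.
  - exact (ex_series_plus (V := R_NormedModule) _ _ Hu Hv).
Qed.

Lemma abs_summable_scal (k : C) (u : nat -> C) :
  abs_summable u -> abs_summable (fun n => k * u n)%C.
Proof.
  intros Hu. apply (abs_summable_le _ (fun n => Cmod k * Cmod (u n))).
  - intros n. rewrite Cmod_mult. apply Rle_refl.
  - exact (ex_series_scal (V := R_NormedModule) (Cmod k) _ Hu).
Qed.

Lemma CSeries_ext (u v : nat -> C) : (forall n, u n = v n) -> CSeries u = CSeries v.
Proof. intros H. unfold CSeries. f_equal; apply Series_ext; intros n; now rewrite H. Qed.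

Lemma CSeries_plus (u v : nat -> C) :
  abs_summable u -> abs_summable v ->
  CSeries (fun n => u n + v n)%C = (CSeries u + CSeries v)%C.
Proof.
  intros Hu Hv. unfold CSeries, Cplus; simpl. f_equal.
  - exact (Series_plus _ _ (ex_series_part u Re (or_introl eq_refl) Hu)
             (ex_series_part v Re (or_introl eq_refl) Hv)).
  - exact (Series_plus _ _ (ex_series_part u Im (or_intror eq_refl) Hu)
             (ex_series_part v Im (or_intror eq_refl) Hv)).
Qed.

Lemma CSeries_scal (k : C) (u : nat -> C) :
  abs_summable u -> CSeries (fun n => k * u n)%C = (k * CSeries u)%C.
Proof.
  intros Hu.
  assert (Hre := ex_series_part u Re (or_introl eq_refl) Hu).
  assert (Him := ex_series_part u Im (or_intror eq_refl) Hu).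
  assert (Hs : forall (x : R) (w : nat -> R), ex_series w -> ex_series (fun n => x * w n)).
  { intros x w Hw. exact (ex_series_scal (V := R_NormedModule) x w Hw). }
  unfold CSeries, Cmult; simpl. f_equal.
  - rewrite <- !Series_scal_l, <- Series_minus by now apply Hs. reflexivity.
  - rewrite <- !Series_scal_l, <- Series_plus by now apply Hs. reflexivity.
Qed.

Lemma CSeries_incr_1 (u : nat -> C) :
  abs_summable u -> CSeries u = (u 0%nat + CSeries (fun n => u (S n)))%C.
Proof.
  intros Hu. unfold CSeries, Cplus; simpl. f_equal.
  - exact (Series_incr_1 _ (ex_series_part u Re (or_introl eq_refl) Hu)).
  - exact (Series_incr_1 _ (ex_series_part u Im (or_intror eq_refl) Hu)).
Qed.

(** The factor 2 comes from summing real and imaginary parts separately; any constant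
    serves for the estimates below. *)
Lemma Cmod_CSeries_le (u : nat -> C) (v : nat -> R) :
  (forall n, Cmod (u n) <= v n) -> ex_series v -> Cmod (CSeries u) <= 2 * Series v.
Proof.
  intros Huv Hv. assert (Hu := abs_summable_le u v Huv Hv).
  assert (Hpart : forall p : C -> R, p = Re \/ p = Im ->
            Rabs (Series (fun n => p (u n))) <= Series v).
  { intros p Hp. eapply Rle_trans; [apply Series_Rabs; now apply ex_series_Rabs_part|].
    apply Series_le; [|exact Hv]. intros n. split; [apply Rabs_pos|].
    eapply Rle_trans; [|apply Huv].
    destruct Hp; subst p; [apply re_le_Cmod | apply Rabs_Im_le_Cmod]. }
  assert (Hre := Hpart Re (or_introl eq_refl)).
  assert (Him := Hpart Im (or_intror eq_refl)).
  eapply Rle_trans; [apply Cmod_2Rmax|].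
  assert (Hm := Rmax_lub _ _ _ Hre Him).
  assert (H2 : sqrt 2 <= 2).
  { rewrite <- (sqrt_Rsqr 2) at 2 by lra. apply sqrt_le_1; unfold Rsqr; lra. }
  assert (H0 := Rle_trans _ _ _ (Rabs_pos _) Hre).
  apply Rle_trans with (2 * Rmax (Rabs (Series (fun n => Re (u n))))
                              (Rabs (Series (fun n => Im (u n))))); [|lra].
  apply Rmult_le_compat_r; [|exact H2].
  exact (Rle_trans _ _ _ (Rabs_pos _) (Rmax_l _ _)).
Qed.

Definition CPSeries (c : nat -> C) (z : C) : C := CSeries (fun n => c n * z ^ n)%C.

(** Radius of convergence at least 1, in the form that is convenient for coefficients
    given by a recurrence, some of which may vanish. *)
Definition subgeometric (c : nat -> C) : Prop :=
  forall r, 0 <= r < 1 -> exists M, forall n, Cmod (c n) * r ^ n <= M.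

Definition PS_Cderive (c : nat -> C) (n : nat) : C := (INR (S n) * c (S n))%C.

Lemma subgeometric_pos (c : nat -> C) :
  (forall r, 0 < r < 1 -> exists M, forall n, Cmod (c n) * r ^ n <= M) -> subgeometric c.
Proof.
  intros H r Hr. destruct (H ((1 + r) / 2)) as [M HM]; [lra|].
  exists M. intros n. eapply Rle_trans; [|apply (HM n)].
  apply Rmult_le_compat_l; [apply Cmod_ge_0|]. apply pow_incr. lra.
Qed.

(** The factor n is absorbed by passing from r to a larger s < 1, because
    n (s/r - 1) <= (s/r)^n by Bernoulli's inequality. *)
Lemma subgeometric_nmul (c : nat -> C) :
  subgeometric c -> subgeometric (fun n => INR n * c n)%C.
Proof.
  intros Hc. apply subgeometric_pos. intros r Hr.
  destruct (Hc ((1 + r) / 2)) as [M HM]; [lra|].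
  set (s := (1 + r) / 2) in *. assert (Hs : r < s < 1) by (unfold s; lra).
  exists (M / (s / r - 1)). intros n.
  assert (Hd : 0 < s / r - 1).
  { assert (1 < s / r); [|lra]. apply Rlt_div_r; lra. }
  rewrite Cmod_mult, Cmod_R, Rabs_right by apply Rle_ge, pos_INR.
  apply -> Rle_div_r; [|exact Hd].
  assert (Hb := poly n (s / r - 1) Hd).
  replace (1 + (s / r - 1)) with (s / r) in Hb by ring.
  eapply Rle_trans; [|apply (HM n)].
  replace (s ^ n) with ((s / r) ^ n * r ^ n).
  2:{ rewrite <- Rpow_mult_distr. f_equal. field. lra. }
  assert (Hr0 : 0 < r ^ n) by (apply pow_lt; lra).
  assert (Hcn := Cmod_ge_0 (c n)).
  assert (0 <= Cmod (c n) * r ^ n) by nra. nra.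
Qed.

Lemma subgeometric_shift (c : nat -> C) :
  subgeometric c -> subgeometric (fun n => c (S n)).
Proof.
  intros Hc. apply subgeometric_pos. intros r Hr.
  destruct (Hc r) as [M HM]; [lra|]. exists (M / r). intros n.
  apply -> Rle_div_r; [|lra]. specialize (HM (S n)). simpl in HM. lra.
Qed.

Lemma subgeometric_PS_Cderive (c : nat -> C) :
  subgeometric c -> subgeometric (PS_Cderive c).
Proof. intros Hc. exact (subgeometric_shift _ (subgeometric_nmul c Hc)). Qed.

Lemma subgeometric_summable (c : nat -> C) (r : R) :
  subgeometric c -> 0 <= r < 1 -> ex_series (fun n => Cmod (c n) * r ^ n).
Proof.
  intros Hc Hr. destruct (Hc ((1 + r) / 2)) as [M HM]; [lra|].
  set (s := (1 + r) / 2) in *. assert (Hs : r < s < 1) by (unfold s; lra).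
  apply (ex_series_le (V := R_CompleteNormedModule) _ (fun n => M * (r / s) ^ n)).
  - intros n. change (Rabs (Cmod (c n) * r ^ n) <= M * (r / s) ^ n).
    assert (Hs0 : 0 <= (r / s) ^ n) by (apply pow_le, Rdiv_le_0_compat; lra).
    assert (Hr0 : 0 <= r ^ n) by (apply pow_le; lra).
    assert (Hcn := Cmod_ge_0 (c n)).
    rewrite Rabs_right by (apply Rle_ge; nra).
    replace (r ^ n) with (s ^ n * (r / s) ^ n).
    2:{ rewrite <- Rpow_mult_distr. f_equal. field. lra. }
    rewrite <- Rmult_assoc. apply Rmult_le_compat_r; [exact Hs0 | apply HM].
  - apply (ex_series_scal (V := R_NormedModule) M). apply ex_series_geom.
    rewrite Rabs_right; [apply Rlt_div_l; lra|].
    apply Rle_ge, Rdiv_le_0_compat; lra.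
Qed.

Lemma CPSeries_summable (c : nat -> C) (z : C) :
  subgeometric c -> Cmod z < 1 -> abs_summable (fun n => c n * z ^ n)%C.
Proof.
  intros Hc Hz. apply (abs_summable_le _ (fun n => Cmod (c n) * Cmod z ^ n)).
  - intros n. rewrite Cmod_mult, Cmod_pow. apply Rle_refl.
  - apply subgeometric_summable; [exact Hc|]. split; [apply Cmod_ge_0 | exact Hz].
Qed.

Lemma CPSeries_ext (c d : nat -> C) (z : C) :
  (forall n, c n = d n) -> CPSeries c z = CPSeries d z.
Proof. intros H. apply CSeries_ext. intros n. now rewrite H. Qed.

Lemma CPSeries_plus (c d : nat -> C) (z : C) :
  subgeometric c -> subgeometric d -> Cmod z < 1 ->
  CPSeries (fun n => c n + d n)%C z = (CPSeries c z + CPSeries d z)%C.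
Proof.
  intros Hc Hd Hz. unfold CPSeries.
  rewrite <- CSeries_plus by now apply CPSeries_summable.
  apply CSeries_ext. intros n. ring.
Qed.

Lemma CPSeries_scal (k : C) (c : nat -> C) (z : C) :
  subgeometric c -> Cmod z < 1 ->
  CPSeries (fun n => k * c n)%C z = (k * CPSeries c z)%C.
Proof.
  intros Hc Hz. unfold CPSeries.
  rewrite <- CSeries_scal by now apply CPSeries_summable.
  apply CSeries_ext. intros n. ring.
Qed.

Lemma CPSeries_shift (c : nat -> C) (z : C) :
  subgeometric c -> Cmod z < 1 ->
  CPSeries c z = (c 0%nat + z * CPSeries (fun n => c (S n)) z)%C.
Proof.
  intros Hc Hz. unfold CPSeries.
  rewrite CSeries_incr_1 by now apply CPSeries_summable.
  rewrite <- CSeries_scal by (apply CPSeries_summable; [now apply subgeometric_shift|exact Hz]).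
  f_equal; [simpl; ring|]. apply CSeries_ext. intros n. simpl. ring.
Qed.

Lemma CPSeries_theta (c : nat -> C) (z : C) :
  subgeometric c -> Cmod z < 1 ->
  (z * CPSeries (PS_Cderive c) z)%C = CPSeries (fun n => INR n * c n)%C z.
Proof.
  intros Hc Hz. rewrite (CPSeries_shift (fun n => INR n * c n)%C).
  - unfold PS_Cderive. simpl INR at 2. ring.
  - now apply subgeometric_nmul.
  - exact Hz.
Qed.

Lemma subgeometric_plus (c d : nat -> C) :
  subgeometric c -> subgeometric d -> subgeometric (fun n => c n + d n)%C.
Proof.
  intros Hc Hd r Hr. destruct (Hc r Hr) as [M HM]. destruct (Hd r Hr) as [M' HM'].
  exists (M + M'). intros n. specialize (HM n). specialize (HM' n).
  assert (H := Cmod_triangle (c n) (d n)).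
  assert (0 <= r ^ n) by (apply pow_le; lra). nra.
Qed.

Lemma subgeometric_scal (k : C) (c : nat -> C) :
  subgeometric c -> subgeometric (fun n => k * c n)%C.
Proof.
  intros Hc r Hr. destruct (Hc r Hr) as [M HM]. exists (Cmod k * M). intros n.
  rewrite Cmod_mult, Rmult_assoc. apply Rmult_le_compat_l; [apply Cmod_ge_0 | apply HM].
Qed.

(** The error E_n of the first-order expansion of y^n satisfies
    E_(n+1) = y E_n + n (y - z)^2 z^(n-1).  The factor r^2 on the left avoids the exponent
    n - 2 on the right. *)
Lemma pow_first_order_bound (y z : C) (r : R) (n : nat) :
  Cmod y <= r -> Cmod z <= r ->
  r ^ 2 * Cmod (y ^ n - z ^ n - (y - z) * (INR n * z ^ pred n))%C
    <= Cmod (y - z)%C ^ 2 * (INR n ^ 2 * r ^ n).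
Proof.
  intros Hy Hz.
  assert (Hr : 0 <= r) by (eapply Rle_trans; [apply Cmod_ge_0 | exact Hy]).
  assert (Hh := pow2_ge_0 (Cmod (y - z)%C)).
  set (h := Cmod (y - z)%C) in *.
  induction n as [|n IH].
  - replace (y ^ 0 - z ^ 0 - (y - z) * (INR 0 * z ^ pred 0))%C with (RtoC 0)
      by (simpl; ring).
    rewrite Cmod_0. simpl. lra.
  - destruct n as [|n].
    { replace (y ^ 1 - z ^ 1 - (y - z) * (INR 1 * z ^ pred 1))%C with (RtoC 0)
        by (simpl; ring).
      rewrite Cmod_0. simpl. rewrite Rmult_0_r. simpl in Hh. nra. }
    set (E := (y ^ S n - z ^ S n - (y - z) * (INR (S n) * z ^ pred (S n)))%C) in *.
    replace (y ^ S (S n) - z ^ S (S n) - (y - z) * (INR (S (S n)) * z ^ pred (S (S n))))%C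
      with (y * E + INR (S n) * ((y - z) * (y - z) * z ^ n))%C.
    2:{ unfold E. rewrite (S_INR (S n)), RtoC_plus. simpl pred. rewrite !Cpow_S. ring. }
    assert (Hn := pos_INR (S n)).
    assert (Hrn : 0 <= r ^ n) by (apply pow_le; lra).
    apply Rle_trans with (r ^ 2 * (r * Cmod E + INR (S n) * (h ^ 2 * r ^ n))).
    { apply Rmult_le_compat_l; [apply pow2_ge_0|].
      eapply Rle_trans; [apply Cmod_triangle|]. apply Rplus_le_compat.
      - rewrite Cmod_mult. apply Rmult_le_compat_r; [apply Cmod_ge_0 | exact Hy].
      - rewrite !Cmod_mult, Cmod_R, Rabs_right, Cmod_pow by (apply Rle_ge; lra).
        apply Rmult_le_compat_l; [exact Hn|]. fold h.
        replace (h ^ 2) with (h * h) by ring.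
        apply Rmult_le_compat_l; [apply Rle_0_sqr|].
        apply pow_incr. split; [apply Cmod_ge_0 | exact Hz]. }
    apply Rle_trans with (r * (h ^ 2 * (INR (S n) ^ 2 * r ^ S n))
                          + r ^ 2 * (INR (S n) * (h ^ 2 * r ^ n))).
    { assert (H := Rmult_le_compat_l r _ _ Hr IH). lra. }
    rewrite (S_INR (S n)). set (N := INR (S n)) in *.
    rewrite <- !tech_pow_Rmult.
    assert (HX : 0 <= h ^ 2 * (r * (r * r ^ n))).
    { apply Rmult_le_pos; [exact Hh|]. nra. }
    set (X := r ^ n) in *. nra.
Qed.

(** Summing [pow_first_order_bound] over the coefficients bounds the error of the linear
    approximation by a constant times |y - z|^2, on a disk |y| <= r with |z| < r < 1. *)
Lemma cderiv_CPSeries (c : nat -> C) (z : C) :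
  subgeometric c -> Cmod z < 1 ->
  cderiv (CPSeries c) z (CPSeries (PS_Cderive c) z).
Proof.
  intros Hc Hz. assert (Hz0 := Cmod_ge_0 z).
  set (r := (1 + Cmod z) / 2). assert (Hr : Cmod z < r < 1) by (unfold r; lra).
  assert (Hc1 := subgeometric_nmul c Hc).
  assert (Hc2 := subgeometric_nmul _ Hc1).
  assert (Hex := subgeometric_summable _ r Hc2 ltac:(lra)).
  set (K := Series (fun n => Cmod (INR n * (INR n * c n))%C * r ^ n)) in *.
  assert (HK : 0 <= K).
  { enough (0 <= 2 * K) by lra.
    apply Rle_trans with (Cmod (CSeries (fun _ => RtoC 0))); [apply Cmod_ge_0|].
    apply Cmod_CSeries_le; [|exact Hex]. intros n. rewrite Cmod_0.
    apply Rmult_le_pos; [apply Cmod_ge_0 | apply pow_le; lra]. }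
  assert (Hr2 : 0 < r ^ 2) by (apply pow_lt; lra).
  assert (Hq : forall y, Cmod y <= r ->
    Cmod (CPSeries c y - CPSeries c z - (y - z) * CPSeries (PS_Cderive c) z)%C
      <= 2 * K / r ^ 2 * Cmod (y - z)%C ^ 2).
  { intros y Hy.
    assert (Hd : CPSeries (PS_Cderive c) z = CSeries (fun n => c n * (INR n * z ^ pred n))%C
                 /\ abs_summable (fun n => c n * (INR n * z ^ pred n))%C).
    { assert (Hs : abs_summable (fun n => c n * (INR n * z ^ pred n))%C).
      { apply (ex_series_incr_1 (V := R_NormedModule)).
        assert (H := CPSeries_summable _ z (subgeometric_PS_Cderive c Hc) Hz).
        revert H. apply ex_series_ext. intros n. f_equal. unfold PS_Cderive. simpl pred. ring. }
      split; [|exact Hs]. rewrite CSeries_incr_1 by exact Hs.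
      replace (c 0%nat * (INR 0 * z ^ pred 0))%C with (RtoC 0) by (simpl; ring).
      rewrite Cplus_0_l. apply CSeries_ext. intros n. unfold PS_Cderive. simpl pred. ring. }
    destruct Hd as [-> Hs].
    assert (Hsy := CPSeries_summable c y Hc ltac:(lra)).
    assert (Hsz := CPSeries_summable c z Hc Hz).
    replace (CPSeries c y - CPSeries c z
             - (y - z) * CSeries (fun n => c n * (INR n * z ^ pred n)))%C
      with (CSeries (fun n => c n * (y ^ n - z ^ n - (y - z) * (INR n * z ^ pred n)))%C).
    2:{ transitivity (CPSeries c y + ((- (1)) * CPSeries c z
             + (- (y - z)) * CSeries (fun n => c n * (INR n * z ^ pred n))))%C; [|ring].
        unfold CPSeries.
        rewrite <- (CSeries_scal (- (1))%C) by exact Hsz.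
        rewrite <- (CSeries_scal (- (y - z))%C) by exact Hs.
        rewrite <- CSeries_plus by (apply abs_summable_scal; assumption).
        rewrite <- CSeries_plus;
          [|exact Hsy|apply abs_summable_plus; apply abs_summable_scal; assumption].
        apply CSeries_ext. intros n. ring. }
    eapply Rle_trans.
    - apply (Cmod_CSeries_le _ (fun n => Cmod (y - z)%C ^ 2 / r ^ 2
               * (Cmod (INR n * (INR n * c n))%C * r ^ n))).
      + intros n. assert (H := pow_first_order_bound y z r n Hy ltac:(lra)).
        rewrite !Cmod_mult, Cmod_R, Rabs_right by apply Rle_ge, pos_INR.
        replace (Cmod (y - z) ^ 2 / r ^ 2 * (INR n * (INR n * Cmod (c n)) * r ^ n))
          with (Cmod (c n) * (Cmod (y - z) ^ 2 * (INR n ^ 2 * r ^ n) / r ^ 2))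
          by (field; lra).
        apply Rmult_le_compat_l; [apply Cmod_ge_0|]. apply -> Rle_div_r; [|exact Hr2]. lra.
      + exact (ex_series_scal (V := R_NormedModule) _ _ Hex).
    - rewrite Series_scal_l. fold K. right. field. lra. }
  apply cderiv_iff. intros eps Heps.
  set (B := 2 * K / r ^ 2) in *.
  assert (HB : 0 <= B) by (unfold B; apply Rdiv_le_0_compat; lra).
  assert (Hd : 0 < eps / (1 + B)) by (apply Rdiv_lt_0_compat; lra).
  exists (Rmin (r - Cmod z) (eps / (1 + B))). split; [apply Rmin_glb_lt; lra|].
  intros y Hy.
  assert (Hy1 := Rlt_le_trans _ _ _ Hy (Rmin_l _ _)).
  assert (Hy2 := Rlt_le_trans _ _ _ Hy (Rmin_r _ _)).
  assert (Ht := Cmod_triangle (y - z) z). replace (y - z + z)%C with y in Ht by ring.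
  eapply Rle_trans; [apply Hq; lra|].
  assert (H0 := Cmod_ge_0 (y - z)).
  apply Rlt_div_r in Hy2; [|lra].
  assert (B * Cmod (y - z) <= eps) by nra. nra.
Qed.

(** * The hypergeometric series and its differential equation *)

Definition hyp_coef (a b c : C) (n : nat) : C :=
  (pochhammer a n * pochhammer b n / (pochhammer c n * INR (fact n)))%C.

Lemma RtoC_neq_0 (x : R) : x <> 0 -> RtoC x <> 0%C.
Proof. intros Hx H. apply Hx. exact (f_equal Re H). Qed.

Lemma pochhammer_neq_0 (c : C) (n : nat) :
  (forall n : nat, c + INR n <> 0)%C -> pochhammer c n <> 0%C.
Proof.
  intros Hc. induction n as [|n IH]; simpl.
  - apply RtoC_neq_0. lra.
  - now apply Cmult_neq_0.
Qed.

Lemma hyp_coef_S (a b c : C) (n : nat) :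
  (forall n : nat, c + INR n <> 0)%C ->
  ((c + INR n) * (INR (S n) * hyp_coef a b c (S n))
   = (a + INR n) * (b + INR n) * hyp_coef a b c n)%C.
Proof.
  intros Hc. unfold hyp_coef. rewrite fact_simpl, mult_INR, RtoC_mult.
  cbn [pochhammer].
  field. split; [|split; [|split]].
  - apply RtoC_neq_0, INR_fact_neq_0.
  - now apply pochhammer_neq_0.
  - apply RtoC_neq_0, not_0_INR. lia.
  - apply Hc.
Qed.

Lemma bounded_of_eventually_decreasing (N : nat) (v : nat -> R) :
  (forall n, (N <= n)%nat -> v (S n) <= v n) -> exists M, forall n, v n <= M.
Proof.
  revert v. induction N as [|N IH]; intros v Hv.
  - exists (v 0%nat). intros n. induction n as [|n IHn]; [apply Rle_refl|].
    eapply Rle_trans; [apply Hv; lia | exact IHn].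
  - destruct (IH (fun n => v (S n))) as [M HM].
    { intros n Hn. apply Hv. lia. }
    exists (Rmax (v 0%nat) M). intros [|n]; [apply Rmax_l|].
    eapply Rle_trans; [apply HM | apply Rmax_r].
Qed.

(** The quotient of consecutive coefficients tends to 1, so |h_n| r^n is eventually
    decreasing.  The quotient is never formed: the coefficients vanish from some index on
    when a or b is a nonpositive integer. *)
Lemma subgeometric_hyp_coef (a b c : C) :
  (forall n : nat, c + INR n <> 0)%C -> subgeometric (hyp_coef a b c).
Proof.
  intros Hc. apply subgeometric_pos. intros r Hr.
  set (t := Cmod a + Cmod b + Cmod c).
  assert (Ha := Cmod_ge_0 a). assert (Hb := Cmod_ge_0 b). assert (Hc0 := Cmod_ge_0 c).
  assert (Ht : 0 <= t) by (unfold t; lra).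
  (* from this N on, (t + n)^2 r <= (n - t) n *)
  destruct (INR_unbounded ((3 * t + t ^ 2) / (1 - r) + 1)) as [N HN].
  assert (Hq : 0 <= (3 * t + t ^ 2) / (1 - r)) by (apply Rdiv_le_0_compat; nra).
  apply (bounded_of_eventually_decreasing N). intros n Hn.
  apply le_INR in Hn.
  assert (Hn1 : 3 * t + t ^ 2 <= INR n * (1 - r)) by (apply Rle_div_l; lra).
  assert (HnN : 1 <= INR n) by lra.
  assert (Hrec := f_equal Cmod (hyp_coef_S a b c n Hc)).
  rewrite !Cmod_mult, Cmod_R, Rabs_right in Hrec by apply Rle_ge, pos_INR.
  assert (Hbound : forall x : C, Cmod x <= t -> Cmod (x + INR n)%C <= t + INR n).
  { intros x Hx. eapply Rle_trans; [apply Cmod_triangle|].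
    rewrite Cmod_R, Rabs_right by lra. lra. }
  assert (Han := Hbound a ltac:(unfold t; lra)).
  assert (Hbn := Hbound b ltac:(unfold t; lra)).
  assert (Hcn : INR n - t <= Cmod (c + INR n)%C).
  { assert (H := Cmod_triangle (c + INR n) (- c)). rewrite Cmod_opp in H.
    replace (c + INR n + - c)%C with (RtoC (INR n)) in H by ring.
    rewrite Cmod_R, Rabs_right in H by lra. unfold t. lra. }
  assert (Han0 := Cmod_ge_0 (a + INR n)). assert (Hbn0 := Cmod_ge_0 (b + INR n)).
  assert (Hcn0 : 0 < Cmod (c + INR n)%C) by apply Cmod_gt_0, Hc.
  set (A := Cmod (a + INR n)%C) in *. set (B := Cmod (b + INR n)%C) in *.
  set (D := Cmod (c + INR n)%C) in *.
  rewrite S_INR in Hrec.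
  assert (Hkey : A * B * r <= D * (INR n + 1)).
  { assert (A * B <= (t + INR n) * (t + INR n)) by (apply Rmult_le_compat; assumption).
    assert (0 <= t * (INR n)) by nra. 
    assert (t ^ 2 <= t ^ 2 * INR n) by nra.
    assert ((t + INR n) * (t + INR n) * r <= (INR n - t) * INR n) by nra.
    nra. }
  set (u := Cmod (hyp_coef a b c n)) in *. set (v := Cmod (hyp_coef a b c (S n))) in *.
  assert (Hu : 0 <= u) by apply Cmod_ge_0.
  assert (Hv : 0 <= v) by apply Cmod_ge_0.
  assert (Hvu : v * r <= u).
  { apply Rmult_le_reg_l with (D * (INR n + 1)); [nra|].
    replace (D * (INR n + 1) * (v * r)) with (D * ((INR n + 1) * v) * r) by ring.
    rewrite Hrec. nra. }
  simpl. assert (0 <= r ^ n) by (apply pow_le; lra). nra.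
Qed.

(** Comparing the coefficients of z^n reduces this to the recurrence [hyp_coef_S]. *)
Lemma hypergeometric_equation (a b c z : C) :
  (forall n : nat, c + INR n <> 0)%C -> Cmod z < 1 ->
  let h := hyp_coef a b c in
  (z * (1 - z) * CPSeries (PS_Cderive (PS_Cderive h)) z
   + (c - (a + b + 1) * z) * CPSeries (PS_Cderive h) z
   = a * b * CPSeries h z)%C.
Proof.
  intros Hc Hz h.
  assert (Hh : subgeometric h) by now apply subgeometric_hyp_coef.
  assert (Hh1 := subgeometric_PS_Cderive h Hh).
  assert (Hn := subgeometric_nmul h Hh).
  (* n (n - 1) h_n, the coefficients of z^2 F'' *)
  set (d := (fun n => INR n * (INR n * h n) + (- (1)) * (INR n * h n))%C).
  assert (Hd : subgeometric d).
  { apply subgeometric_plus; [|apply subgeometric_scal]; now repeat apply subgeometric_nmul. }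
  assert (E1 := CPSeries_theta _ z Hh1 Hz).
  assert (E2 := CPSeries_theta _ z Hh Hz).
  assert (E3 : (z * CPSeries (fun n => INR n * PS_Cderive h n) z)%C = CPSeries d z).
  { rewrite (CPSeries_shift d z Hd Hz). replace (d 0%nat) with (RtoC 0).
    2:{ unfold d. simpl INR. ring. }
    rewrite Cplus_0_l. f_equal. apply CPSeries_ext. intros n.
    unfold d, PS_Cderive. rewrite S_INR, RtoC_plus. ring. }
  assert (E4 : (z * CPSeries (PS_Cderive (PS_Cderive h)) z + c * CPSeries (PS_Cderive h) z
                = CPSeries d z + (a + b + 1) * CPSeries (fun n => INR n * h n) z
                  + a * b * CPSeries h z)%C).
  { rewrite E1, <- !CPSeries_scal by assumption.
    assert (Hs1 := subgeometric_scal c _ Hh1).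
    assert (Hs2 := subgeometric_scal (a + b + 1) _ Hn).
    assert (Hs3 := subgeometric_scal (a * b) _ Hh).
    rewrite <- !CPSeries_plus; try assumption;
      try (now apply subgeometric_plus); try (now apply subgeometric_nmul).
    apply CPSeries_ext. intros n.
    assert (H := hyp_coef_S a b c n Hc). fold h in H. fold (PS_Cderive h n) in H.
    transitivity ((c + INR n) * PS_Cderive h n)%C; [ring|]. rewrite H. unfold d. ring. }
  rewrite <- E3, <- E1, <- E2 in E4.
  set (F2 := CPSeries (PS_Cderive (PS_Cderive h)) z) in *.
  set (F1 := CPSeries (PS_Cderive h) z) in *. set (F := CPSeries h z) in *.
  transitivity ((z * F2 + c * F1) - z * (z * F2) - (a + b + 1) * (z * F1))%C; [ring|].
  rewrite E4. ring.
Qed.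

Lemma CPSeries_at_0 (c : nat -> C) : subgeometric c -> CPSeries c 0 = c 0%nat.
Proof.
  intros Hc. rewrite CPSeries_shift; [ring | exact Hc | rewrite Cmod_0; lra].
Qed.

(** * The first point where the subordination fails *)

(** p exp (K t) is nondecreasing. *)
Lemma backward_gronwall (p p1 : R -> R) (d K : R) :
  d < 1 ->
  (forall t, d <= t <= 1 -> is_derive p t (p1 t)) ->
  (forall t, d <= t <= 1 -> - K * p t <= p1 t) ->
  p 1 = 0 -> p d <= 0.
Proof.
  intros Hd Hp Hp1 Hp0.
  destruct (MVT_cor2 (fun t => p t * exp (K * t))
              (fun t => p1 t * exp (K * t) + p t * (K * exp (K * t))) d 1 Hd) as [s [Hs1 Hs2]].
  { intros t Ht. apply is_derive_Reals. evar_last.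
    - apply (is_derive_mult (K := R_AbsRing)).
      + now apply Hp.
      + apply (is_derive_comp exp (fun t => K * t)); [apply is_derive_exp|].
        apply is_derive_scal. apply is_derive_id.
      + exact Rmult_comm.
    - unfold plus, mult, scal, one; simpl. unfold mult; simpl. ring. }
  rewrite Hp0 in Hs1. assert (H := Hp1 s ltac:(lra)).
  assert (He := exp_pos (K * s)). assert (Hed := exp_pos (K * d)).
  assert (0 <= (p1 s * exp (K * s) + p s * (K * exp (K * s))) * (1 - d)).
  { apply Rmult_le_pos; [|lra]. nra. }
  nra.
Qed.

Lemma Rabs_Cdot_le (x y : C) : Rabs (Cdot x y) <= Cmod x * Cmod y.
Proof. unfold Cdot. eapply Rle_trans; [apply re_le_Cmod|]. rewrite Cmod_mult, Cmod_conj. lra. Qed.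

(** Uniqueness for a linear equation, carried from z along the segment towards the singular
    point 0: at each point d z with 0 < d < 1, Gronwall's inequality for
    |F|^2 + |F1|^2 on [d, 1] gives F (d z) = 0, and then F 0 = 0 by continuity. *)
Lemma ode_no_common_zero (F F1 F2 : C -> C) (c p : C) :
  (forall z, Cmod z < 1 -> cderiv F z (F1 z)) ->
  (forall z, Cmod z < 1 -> cderiv F1 z (F2 z)) ->
  (forall z, Cmod z < 1 -> z * (1 - z) * F2 z + c * (1 - z) * F1 z = p * F z)%C ->
  F 0%C <> 0%C ->
  forall z, Cmod z < 1 -> F z = 0%C -> F1 z = 0%C -> False.
Proof.
  intros HF HF1 Hode HF0 z0 Hz0 HFz HF1z.
  assert (Hz00 := Cmod_ge_0 z0).
  assert (Hin : forall t, 0 <= t <= 1 -> Cmod (0 + t * z0)%C <= Cmod z0).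
  { intros t Ht. rewrite Cplus_0_l, Cmod_mult, Cmod_R, Rabs_right by lra. nra. }
  assert (Hseg : forall d, 0 < d < 1 -> F (0 + d * z0)%C = 0%C).
  { intros d Hd.
    set (K := (Cmod p + 2 * Cmod c) / (d * (1 - Cmod z0))).
    assert (Hp0 := Cmod_ge_0 p). assert (Hc0 := Cmod_ge_0 c).
    assert (Hdz : 0 < d * (1 - Cmod z0)) by nra.
    assert (HK : 0 <= K) by (apply Rdiv_le_0_compat; lra).
    pose (q := fun t : R => Cmod (F (0 + t * z0)%C) ^ 2 + Cmod (F1 (0 + t * z0)%C) ^ 2).
    assert (Hq : q d <= 0).
    { apply (backward_gronwall q
        (fun t => 2 * Cdot (F (0 + t * z0)%C) (z0 * F1 (0 + t * z0)%C)
                + 2 * Cdot (F1 (0 + t * z0)%C) (z0 * F2 (0 + t * z0)%C)) d (1 + 3 * K)); [lra| | |].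
      - intros t Ht. assert (Hzt := Hin t ltac:(lra)).
        apply (is_derive_plus (K := R_AbsRing) (V := R_NormedModule));
          apply is_derive_Cmod2_line; [apply HF | apply HF1]; lra.
      - intros t Ht. unfold q. assert (Hzt := Hin t ltac:(lra)).
        set (z := (0 + t * z0)%C) in *.
        assert (Hz1 : Cmod z < 1) by lra.
        assert (HE := Hode z Hz1).
        set (x := Cmod (F z)). set (y := Cmod (F1 z)).
        assert (Hx : 0 <= x) by apply Cmod_ge_0. assert (Hy : 0 <= y) by apply Cmod_ge_0.
        assert (H1z : 1 - Cmod z0 <= Cmod (1 - z)%C <= 2).
        { split.
          - assert (H := Cmod_triangle (1 - z) z). replace (1 - z + z)%C with (RtoC 1) in H by ring.
            rewrite Cmod_1 in H. lra.
          - assert (H := Cmod_triangle 1 (- z)). rewrite Cmod_1, Cmod_opp in H.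
            change (1 + - z)%C with (1 - z)%C in H. lra. }
        set (w := Cmod (z0 * F2 z)%C).
        assert (Hw0 : 0 <= w) by apply Cmod_ge_0.
        (* the equation, divided by t (1 - z), where t >= d and |1 - z| >= 1 - |z0| *)
        assert (Hw : w <= K * (x + y)).
        { assert (HE' : (RtoC t * ((1 - z) * (z0 * F2 z)) = p * F z + - (c * ((1 - z) * F1 z)))%C).
          { rewrite <- HE. unfold z. ring. }
          assert (HN := f_equal Cmod HE').
          assert (Htri := Cmod_triangle (p * F z) (- (c * ((1 - z) * F1 z)))).
          rewrite <- HN, Cmod_opp, !Cmod_mult, Cmod_R, Rabs_right in Htri by lra.
          rewrite <- Cmod_mult in Htri. fold x y w in Htri.
          unfold K. replace ((Cmod p + 2 * Cmod c) / (d * (1 - Cmod z0)) * (x + y))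
            with ((Cmod p + 2 * Cmod c) * (x + y) / (d * (1 - Cmod z0))) by (field; nra).
          apply -> Rle_div_r; [|exact Hdz].
          assert (H1 : d * (1 - Cmod z0) * w <= t * (Cmod (1 - z) * w)).
          { rewrite <- Rmult_assoc. apply Rmult_le_compat_r; [exact Hw0|].
            apply Rmult_le_compat; lra. }
          assert (H2 : Cmod c * (Cmod (1 - z) * y) <= Cmod c * (2 * y)).
          { apply Rmult_le_compat_l; [exact Hc0|]. apply Rmult_le_compat_r; lra. }
          assert (0 <= Cmod p * y) by (apply Rmult_le_pos; lra).
          assert (0 <= Cmod c * x) by (apply Rmult_le_pos; lra). nra. }
        assert (HA := Rabs_Cdot_le (F z) (z0 * F1 z)).
        assert (HB := Rabs_Cdot_le (F1 z) (z0 * F2 z)).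
        rewrite Cmod_mult in HA. fold x y in HA. fold y w in HB.
        apply Rabs_le_between in HA. apply Rabs_le_between in HB.
        assert (HA' : x * (Cmod z0 * y) <= x * y).
        { apply Rmult_le_compat_l; [exact Hx|]. nra. }
        assert (HB' : y * w <= y * (K * (x + y))) by (apply Rmult_le_compat_l; assumption).
        assert (HC : 2 * (y * (K * (x + y))) <= 3 * K * (x ^ 2 + y ^ 2)).
        { replace (2 * (y * (K * (x + y)))) with (K * (2 * y * (x + y))) by ring.
          replace (3 * K * (x ^ 2 + y ^ 2)) with (K * (3 * (x ^ 2 + y ^ 2))) by ring.
          apply Rmult_le_compat_l; [exact HK|].
          assert (H := pow2_ge_0 (x - y)). nra. }
        assert (H := pow2_ge_0 (x - y)). nra.
      - unfold q. replace (0 + 1%R * z0)%C with z0 by ring.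
        rewrite HFz, HF1z, Cmod_0. ring. }
    apply Cmod_eq_0. unfold q in Hq.
    assert (H1 := pow2_ge_0 (Cmod (F1 (0 + d * z0)%C))).
    assert (H2 := Cmod_ge_0 (F (0 + d * z0)%C)). nra. }
  assert (HF0' : 0 < Cmod (F 0%C)) by now apply Cmod_gt_0.
  destruct (cderiv_continuous F 0 _ (HF 0%C ltac:(rewrite Cmod_0; lra)) _ HF0') as [e [He0 He]].
  pose (d := Rmin (1 / 2) (e / 2)).
  assert (Hd1 : 0 < d) by (apply Rmin_glb_lt; lra).
  assert (Hd2 : d <= 1 / 2) by apply Rmin_l. assert (Hd3 : d <= e / 2) by apply Rmin_r.
  specialize (He (0 + d * z0)%C). rewrite Hseg in He by lra.
  replace (0 - F 0)%C with (- F 0)%C in He by ring. rewrite Cmod_opp in He.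
  apply (Rlt_irrefl (Cmod (F 0%C))), He.
  replace (0 + d * z0 - 0)%C with (d * z0)%C by ring.
  rewrite Cmod_mult, Cmod_R, Rabs_right by lra. nra.
Qed.

Lemma Cmod_diff_le (x y : C) : Cmod x - Cmod y <= Cmod (x - y)%C.
Proof.
  assert (H := Cmod_triangle (x - y) y). replace (x - y + y)%C with x in H by ring. lra.
Qed.

Lemma Cmod_lt_open (f g : C -> C) (u l m : C) :
  cderiv f u l -> cderiv g u m -> Cmod (f u) < Cmod (g u) ->
  exists d, 0 < d /\ forall z, Cmod (z - u)%C < d -> Cmod (f z) < Cmod (g z).
Proof.
  intros Hf Hg Hlt.
  assert (He : 0 < (Cmod (g u) - Cmod (f u)) / 2) by lra.
  destruct (cderiv_continuous f u l Hf _ He) as [d1 [Hd1 H1]].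
  destruct (cderiv_continuous g u m Hg _ He) as [d2 [Hd2 H2]].
  exists (Rmin d1 d2). split; [now apply Rmin_glb_lt|]. intros z Hz.
  specialize (H1 z (Rlt_le_trans _ _ _ Hz (Rmin_l _ _))).
  specialize (H2 z (Rlt_le_trans _ _ _ Hz (Rmin_r _ _))).
  assert (H3 := Cmod_diff_le (f z) (f u)).
  assert (H4 := Cmod_diff_le (g u) (g z)).
  replace (g u - g z)%C with (- (g z - g u))%C in H4 by ring. rewrite Cmod_opp in H4. lra.
Qed.

(** Here w = A / Q.  At a point of least modulus where |w| < 1 fails we have |w| = 1; the
    last equation is z w' = (m + 1) w multiplied by Q^2, a form that still makes sense
    when F vanishes.  The hypothesis on common zeros keeps Q from vanishing on the closed
    disk up to that point: |A| <= |Q| = 0 would give F1 = 0 and F = 0. *)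
Lemma first_boundary_contact (F F1 F2 F3 : C -> C) (k : C) :
  (forall z, Cmod z < 1 -> cderiv F z (F1 z)) ->
  (forall z, Cmod z < 1 -> cderiv F1 z (F2 z)) ->
  (forall z, Cmod z < 1 -> cderiv F2 z (F3 z)) ->
  k <> 0%C -> F 0%C <> 0%C ->
  (forall z, Cmod z < 1 -> F z = 0%C -> F1 z = 0%C -> False) ->
  let A := (fun z => z * F1 z)%C in
  let Q := (fun z => k * F z + A z)%C in
  let T := (fun z => A z + z * z * F2 z)%C in
  (forall z, Cmod z < 1 -> Cmod (A z) < Cmod (Q z)) \/
  exists z m, Cmod z < 1 /\ 0 <= m /\ Q z <> 0%C /\ Cmod (A z) = Cmod (Q z) /\
    (k * (F z * T z - A z * A z) = (m + 1)%R * (A z * Q z))%C.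
Proof.
  intros HF HF1 HF2 Hk HF0 Hzero A Q T.
  assert (HA : forall z, Cmod z < 1 -> cderiv A z (1 * F1 z + z * F2 z)%C).
  { intros z Hz. apply cderiv_mult; [apply cderiv_id | now apply HF1]. }
  pose (Q1 := (fun z => k * F1 z + (1 * F1 z + z * F2 z))%C).
  assert (HQ : forall z, Cmod z < 1 -> cderiv Q z (Q1 z)).
  { intros z Hz. apply cderiv_plus; [|now apply HA].
    refine (cderiv_ext _ _ _ _ _ (fun x => eq_refl) _
              (cderiv_mult _ _ _ _ _ (cderiv_const k z) (HF z Hz))). ring. }
  destruct (excluded_middle_informative
              (forall z, Cmod z < 1 -> Cmod (A z) < Cmod (Q z))) as [H|Hno]; [now left|right].
  apply not_all_ex_not in Hno. destruct Hno as [z1 Hno].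
  apply imply_to_and in Hno. destruct Hno as [Hz1 Hno]. apply Rnot_lt_le in Hno.
  destruct (max_on_compact (fun z => Cmod z <= Cmod z1 /\ Cmod (Q z) <= Cmod (A z))
              (fun z => - Cmod z) (Cmod z1)) as [z0 [[Hz01 HQA] Hmin]].
  { tauto. }
  { intros u Hu. destruct (Rle_lt_dec (Cmod u) (Cmod z1)) as [Hle|Hlt].
    - assert (Hu1 : Cmod u < 1) by lra.
      destruct (Cmod_lt_open A Q u _ _ (HA u Hu1) (HQ u Hu1)) as [d [Hd0 Hd]].
      { apply Rnot_le_lt. tauto. }
      exists d. split; [exact Hd0|]. intros z Hz [_ H]. specialize (Hd z Hz). lra.
    - exists (Cmod u - Cmod z1). split; [lra|]. intros z Hz [H _].
      assert (H1 := Cmod_diff_le u z).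
      replace (u - z)%C with (- (z - u))%C in H1 by ring. rewrite Cmod_opp in H1. lra. }
  { intros u _ eps Heps. exists eps. split; [exact Heps|]. intros z _ Hz.
    assert (H1 := Cmod_diff_le u z).
    replace (u - z)%C with (- (z - u))%C in H1 by ring. rewrite Cmod_opp in H1. lra. }
  { exists z1. split; [apply Rle_refl | exact Hno]. }
  set (r := Cmod z0) in *.
  assert (Hr1 : r < 1) by lra.
  assert (HQ0 : Q 0%C <> 0%C).
  { unfold Q, A. replace (k * F 0 + 0 * F1 0)%C with (k * F 0)%C by ring. now apply Cmult_neq_0. }
  assert (Hr : 0 < r).
  { apply Cmod_gt_0. intros ->. apply Cmod_gt_0 in HQ0.
    unfold A in HQA. rewrite Cmult_0_l, Cmod_0 in HQA. lra. }
  assert (Hins : forall z, Cmod z < r -> Cmod (A z) < Cmod (Q z)).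
  { intros z Hz. apply Rnot_le_lt. intros H. specialize (Hmin z). lra. }
  assert (Hcl : forall z, Cmod z <= r -> Cmod (A z) <= Cmod (Q z)).
  { intros z Hz. apply Rnot_lt_le. intros Hlt. assert (Hz1' : Cmod z < 1) by lra.
    destruct (Cmod_lt_open Q A z _ _ (HQ z Hz1') (HA z Hz1') Hlt) as [d [Hd0 Hd]].
    pose (t := Rmin (1 / 2) (d / 2)).
    assert (Ht1 : 0 < t) by (apply Rmin_glb_lt; lra).
    assert (Ht2 : t <= 1 / 2) by apply Rmin_l. assert (Ht3 : t <= d / 2) by apply Rmin_r.
    assert (H1 : Cmod ((1 - t)%R * z)%C < r).
    { rewrite Cmod_mult, Cmod_R, Rabs_right by lra. assert (H := Cmod_ge_0 z). nra. }
    assert (H2 : Cmod ((1 - t)%R * z - z)%C < d).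
    { replace ((1 - t)%R * z - z)%C with (- (t * z))%C by (rewrite RtoC_minus; ring).
      rewrite Cmod_opp, Cmod_mult, Cmod_R, Rabs_right by lra.
      assert (H := Cmod_ge_0 z). nra. }
    apply Hins in H1. apply Hd in H2. lra. }
  assert (Heq : Cmod (A z0) = Cmod (Q z0)).
  { apply Rle_antisym; [|exact HQA]. apply Hcl. apply Rle_refl. }
  assert (HQn : forall z, Cmod z <= r -> Q z <> 0%C).
  { intros z Hz HQz. assert (H := Hcl z Hz). rewrite HQz, Cmod_0 in H.
    assert (HAz : A z = 0%C) by (apply Cmod_eq_0, Rle_antisym; [exact H | apply Cmod_ge_0]).
    destruct (Ceq_dec z 0) as [->|Hzn]; [now apply HQ0|].
    apply (Hzero z); [lra| |].
    - unfold Q in HQz. rewrite HAz, Cplus_0_r in HQz.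
      destruct (Ceq_dec (F z) 0) as [H0|H0]; [exact H0|].
      now destruct (Cmult_neq_0 _ _ Hk H0).
    - destruct (Ceq_dec (F1 z) 0) as [H0|H0]; [exact H0|].
      now destruct (Cmult_neq_0 _ _ Hzn H0). }
  (* g = w / z, holomorphic at 0 as well, with |g| = |w| / r <= 1 / r on the circle *)
  pose (g := (fun z => F1 z * / Q z)%C).
  pose (g1 := (fun z => F2 z * / Q z + F1 z * (- Q1 z / (Q z * Q z)))%C).
  assert (Hg : forall z, Cmod z <= r -> cderiv g z (g1 z)).
  { intros z Hz. apply (cderiv_mult F1 (fun y => / Q y)%C); [apply HF1; lra|].
    apply (cderiv_inv Q); [apply HQ; lra | now apply HQn]. }
  assert (Hg1 : forall z, Cmod z <= r -> exists l, cderiv g1 z l).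
  { intros z Hz. assert (Hz' : Cmod z < 1) by lra. assert (HQz := HQn z Hz).
    assert (HQi := cderiv_inv Q _ _ (HQ z Hz') HQz).
    assert (HQ1 : exists l, cderiv Q1 z l).
    { eexists. apply cderiv_plus.
      - apply cderiv_mult; [apply cderiv_const | now apply HF1].
      - apply cderiv_plus.
        + apply cderiv_mult; [apply cderiv_const | now apply HF1].
        + apply cderiv_mult; [apply cderiv_id | now apply HF2]. }
    destruct HQ1 as [l Hl]. eexists. apply cderiv_plus.
    - apply cderiv_mult; [now apply HF2 | exact HQi].
    - apply cderiv_mult; [now apply HF1|].
      apply (cderiv_mult (fun y => - Q1 y)%C (fun y => / (Q y * Q y))%C).
      + apply cderiv_opp, Hl.
      + apply (cderiv_inv (fun y => Q y * Q y)%C).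
        * apply cderiv_mult; now apply HQ.
        * now apply Cmult_neq_0. }
  assert (Hgmod : forall z, Cmod z = r -> Cmod (g z) = Cmod (A z) / Cmod (Q z) / r).
  { intros z Hz. unfold g, A. assert (HQz := HQn z ltac:(lra)).
    rewrite !Cmod_mult, Cmod_inv, Hz by exact HQz.
    apply Cmod_gt_0 in HQz. field. lra. }
  assert (HQ0z := HQn z0 (Rle_refl r)).
  assert (HQ0m : 0 < Cmod (Q z0)) by now apply Cmod_gt_0.
  assert (Hgz0 : Cmod (g z0) = / r).
  { rewrite Hgmod, Heq by reflexivity. field. lra. }
  destruct (boundary_max_derivative g g1 r z0 Hr Hg Hg1 eq_refl) as [m [Hm HE]].
  { intros z Hz. rewrite Hgz0, Hgmod by exact Hz.
    assert (H := Hcl z ltac:(lra)).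
    assert (HQz : 0 < Cmod (Q z)) by (apply Cmod_gt_0, HQn; lra).
    apply Rle_trans with (1 / r); [|lra].
    apply Rmult_le_compat_r; [apply Rlt_le, Rinv_0_lt_compat; exact Hr|].
    apply Rle_div_l; lra. }
  { apply Cmod_gt_0. rewrite Hgz0. now apply Rinv_0_lt_compat. }
  exists z0, m. repeat split; try assumption.
  assert (HE2 : (z0 * (z0 * (F2 z0 * Q z0 - F1 z0 * Q1 z0)) = m * (A z0 * Q z0))%C).
  { transitivity (z0 * (Q z0 * Q z0) * (z0 * g1 z0))%C.
    - unfold g1. field. exact HQ0z.
    - rewrite HE. unfold g, A. field. exact HQ0z. }
  rewrite RtoC_plus.
  transitivity (m * (A z0 * Q z0) + A z0 * Q z0)%C; [|ring].
  rewrite <- HE2. unfold T, Q1, Q, A. ring.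
Qed.

(** * The differential equation at the contact point *)

Lemma quadratic_nonneg (L M N s : R) :
  L >= 0 -> N >= 0 -> L * N - M ^ 2 >= 0 -> 0 <= L * s ^ 2 - 2 * M * s + N.
Proof.
  intros HL HN HD. destruct (Req_dec L 0) as [->|HL0].
  - assert (M = 0) by nra. subst. lra.
  - apply Rmult_le_reg_l with L; [lra|]. assert (H := pow2_ge_0 (L * s - M)). nra.
Qed.

(** With W = e^(-i lam) a b, n2 = |a b|^2 / kap and X = k Z, the left-hand side is
    (2 Re (X conj (a b)) + |a b|^2) / kap.  The three coefficients of the resulting
    quadratic in s are where L, M and N come from. *)
Lemma contact_identity (lam alpha m s n2 : R) (a b W y : C) :
  y = (- (1 / 2), s / 2) ->
  let kap := (1 - alpha) * cos lam in
  let v := expi (- (2 * lam)) in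
  let L := Re (W * (2 - alpha + (1 - alpha) * v))%C in
  let M := Im (W * (Cconj a + Cconj b - (1 - alpha) * (1 + v)))%C in
  let N := Re (W * (2 * Cconj a + 2 * Cconj b + alpha - (1 - alpha) * v))%C - n2 in
  let Z := ((2 * kap)%R * expi lam * (y * y) + (m + 1)%R * (y * (1 + y)) + (a + b) * y)%C in
  4 * Re (Z * Cconj W) + n2
  = - (L * s ^ 2 - 2 * M * s + N) - m * (1 + s ^ 2) * Re W.
Proof.
  intros ->. destruct a as [a1 a2], b as [b1 b2], W as [w1 w2].
  unfold expi. rewrite cos_neg, sin_neg, cos_2a_cos, sin_2a. simpl. field.
Qed.

Lemma Cmod2_plus (x y : C) :
  Cmod (x + y)%C ^ 2 = Cmod x ^ 2 + 2 * Re (x * Cconj y)%C + Cmod y ^ 2.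
Proof. rewrite !Cmod2_alt. destruct x, y. simpl. ring. Qed.

Lemma Cmod_eq_shift_Re (y : C) : Cmod y = Cmod (y + 1)%C -> Re y = - (1 / 2).
Proof.
  intros H. assert (H2 := f_equal (fun x => x ^ 2) H). cbv beta in H2.
  rewrite Cmod2_plus, Cmod_1 in H2. destruct y. simpl in *. lra.
Qed.

Lemma Cconj_expi (t : R) : Cconj (expi t) = expi (- t).
Proof. unfold expi, Cconj; simpl. now rewrite cos_neg, sin_neg. Qed.

(** Both equations at the contact point are polynomial in F, A and T, so a zero of F is
    covered: there A = Q and the first equation gives k = - (m + 1), but Re k > 0.  If
    F <> 0, eliminating T leaves X = z (X + a b), against [contact_identity]. *)
Lemma boundary_contact_impossible (lam alpha m : R) (a b z F A T : C) :
  0 < cos lam -> alpha < 1 ->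
  let u := expi (- lam) in
  let v := expi (- (2 * lam)) in
  let L := Re (u * a * b * (2 - alpha + (1 - alpha) * v))%C in
  let M := Im (u * a * b * (Cconj a + Cconj b - (1 - alpha) * (1 + v)))%C in
  let N := (Re (u * a * b * (2 * Cconj a + 2 * Cconj b + alpha - (1 - alpha) * v))%C
            - (Cmod a ^ 2 * Cmod b ^ 2) / ((1 - alpha) * cos lam))%R in
  let k := ((2 * ((1 - alpha) * cos lam))%R * expi lam)%C in
  let Q := (k * F + A)%C in
  Re (u * a * b)%C > 0 ->
  L >= 0 -> N >= 0 -> L * N - M ^ 2 >= 0 ->
  Cmod z < 1 -> 0 <= m -> Q <> 0%C -> Cmod A = Cmod Q ->
  (k * (F * T - A * A) = (m + 1)%R * (A * Q))%C ->
  ((1 - z) * (T + (a + b) * A) = z * (a * b * F))%C ->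
  False.
Proof.
  intros Hcos Halpha u v L M N k Q HW HL HN HLN Hz Hm HQ HAQ HE Hode.
  set (W := (u * a * b)%C) in *.
  set (kap := (1 - alpha) * cos lam) in *.
  assert (Hkap : 0 < kap) by (unfold kap; nra).
  assert (Hrek : 0 < Re k).
  { unfold k. rewrite re_scal_l. unfold expi. simpl. nra. }
  assert (Hk : k <> 0%C) by (intros H; rewrite H in Hrek; simpl in Hrek; lra).
  destruct (Ceq_dec F 0) as [HF|HF].
  - unfold Q in HE, HQ. rewrite HF in HE, HQ.
    replace (k * 0 + A)%C with A in HE, HQ by ring.
    assert (Hkm : k = RtoC (- (m + 1))).
    { replace k with ((k * (0 * T - A * A)) / (- (A * A)))%C by (field; exact HQ).
      rewrite HE, RtoC_opp. field. exact HQ. }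
    rewrite Hkm in Hrek. simpl in Hrek. lra.
  - set (y := (A / (k * F))%C).
    assert (HA : A = (k * F * y)%C) by (unfold y; field; now split).
    assert (Hy : Re y = - (1 / 2)).
    { apply Cmod_eq_shift_Re.
      assert (HkF : 0 < Cmod (k * F)%C) by (apply Cmod_gt_0; now apply Cmult_neq_0).
      apply Rmult_eq_reg_l with (Cmod (k * F)%C); [|lra].
      rewrite <- !Cmod_mult, <- HA, HAQ. unfold Q. f_equal. rewrite HA at 1. ring. }
    set (s := 2 * Im y).
    assert (Hys : y = (- (1 / 2), s / 2)).
    { rewrite (surjective_pairing y). f_equal; [exact Hy|]. unfold s, Im. field. }
    set (Z := (k * (y * y) + (m + 1)%R * (y * (1 + y)) + (a + b) * y)%C).
    assert (HT : (T + (a + b) * A = F * (k * Z))%C).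
    { assert (HT0 : (T = (k * (F * T - A * A)) / (k * F) + A * A / F)%C)
        by (field; now split).
      rewrite HT0, HE. unfold Q, Z. rewrite HA. field. now split. }
    set (X := (k * Z)%C).
    assert (HX : (X = z * (X + a * b))%C).
    { rewrite HT in Hode.
      assert (H : ((1 - z) * X = z * (a * b))%C).
      { unfold X.
        transitivity ((1 - z) * (F * (k * Z)) / F)%C; [field; exact HF|].
        rewrite Hode. field. exact HF. }
      transitivity ((1 - z) * X + z * X)%C; [ring|]. rewrite H. ring. }
    assert (Hab : (a * b)%C <> 0%C).
    { intros H. unfold W in HW. replace (u * a * b)%C with (u * (a * b))%C in HW by ring.
      rewrite H, Cmult_0_r in HW. simpl in HW. lra. }
    assert (HXab : (X + a * b)%C <> 0%C).
    { intros H. apply Hab. rewrite H, Cmult_0_r in HX. rewrite HX, Cplus_0_l in H. exact H. }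
    assert (Hlt : Cmod X < Cmod (X + a * b)%C).
    { apply Cmod_gt_0 in HXab. rewrite HX at 1. rewrite Cmod_mult. nra. }
    assert (Hpos : 0 < 2 * Re (X * Cconj (a * b))%C + Cmod (a * b)%C ^ 2).
    { assert (H := Cmod2_plus X (a * b)). assert (H0 := Cmod_ge_0 X). nra. }
    assert (HXZ : (X * Cconj (a * b) = (2 * kap)%R * (Z * Cconj W))%C).
    { assert (H2 : (Cconj u = expi lam)%C).
      { unfold u. rewrite Cconj_expi. f_equal. ring. }
      unfold X, W, k. rewrite !Cmult_conj, H2. ring. }
    rewrite HXZ, re_scal_l, Cmod_mult, Rpow_mult_distr in Hpos.
    assert (HI := contact_identity lam alpha m s (Cmod a ^ 2 * Cmod b ^ 2 / kap) a b W y Hys).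
    cbv zeta in HI. fold kap v k Z L M N in HI.
    assert (Hq := quadratic_nonneg L M N s HL HN HLN).
    assert (Hms : 0 <= m * (1 + s ^ 2) * Re W).
    { apply Rmult_le_pos; [|lra]. apply Rmult_le_pos; [exact Hm|].
      assert (H := pow2_ge_0 s). lra. }
    assert (Hle : 4 * Re (Z * Cconj W) + Cmod a ^ 2 * Cmod b ^ 2 / kap <= 0) by lra.
    assert (Hle' := Rmult_le_compat_l kap _ _ (Rlt_le _ _ Hkap) Hle).
    replace (kap * (4 * Re (Z * Cconj W) + Cmod a ^ 2 * Cmod b ^ 2 / kap))
      with (2 * (2 * kap * Re (Z * Cconj W)) + Cmod a ^ 2 * Cmod b ^ 2) in Hle'
      by (field; lra).
    lra.
Qed.

(** * Spirallikeness *)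

Theorem theorem3 (lam alpha : R) (a b : C)
  (hlam : (Rabs lam < PI / 2)%R)
  (halpha : (0 <= alpha < 1)%R)
  (hab : forall n : nat, (1 <= n)%nat -> (a + b)%C <> RtoC (- INR n)) :
  let u := expi (- lam) in
  let v := expi (- (2 * lam)) in
  let L := Re (u * a * b * (2 - alpha + (1 - alpha) * v))%C in
  let M := Im (u * a * b * (Cconj a + Cconj b - (1 - alpha) * (1 + v)))%C in
  let N := (Re (u * a * b * (2 * Cconj a + 2 * Cconj b + alpha - (1 - alpha) * v))%C
            - (Cmod a ^ 2 * Cmod b ^ 2) / ((1 - alpha) * cos lam))%R in
  (Re (u * a * b)%C > 0)%R ->
  (L >= 0 /\ N >= 0 /\ L * N - M ^ 2 >= 0)%R ->
  spirallike lam alpha (fun z : C => (z * hyp2F1 a b (a + b + 1) z)%C).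
Proof.
  intros u v L M N HW [HL [HN HLN]].
  assert (Hcos : 0 < cos lam).
  { apply Rabs_lt_between in hlam. apply cos_gt_0; lra. }
  assert (Hc : forall n : nat, (a + b + 1 + INR n)%C <> 0%C).
  { intros n H. apply (hab (S n)); [lia|].
    rewrite S_INR, RtoC_opp, RtoC_plus.
    transitivity ((a + b + 1 + INR n) - (INR n + 1))%C; [ring|]. rewrite H. ring. }
  set (h := hyp_coef a b (a + b + 1)).
  assert (Hh : subgeometric h) by now apply subgeometric_hyp_coef.
  set (F := CPSeries h). set (F1 := CPSeries (PS_Cderive h)).
  set (F2 := CPSeries (PS_Cderive (PS_Cderive h))).
  set (F3 := CPSeries (PS_Cderive (PS_Cderive (PS_Cderive h)))).
  change (hyp2F1 a b (a + b + 1)) with F.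
  assert (HF : forall z, Cmod z < 1 -> cderiv F z (F1 z)).
  { intros z Hz. now apply cderiv_CPSeries. }
  assert (HF1 : forall z, Cmod z < 1 -> cderiv F1 z (F2 z)).
  { intros z Hz. apply cderiv_CPSeries; [now apply subgeometric_PS_Cderive | exact Hz]. }
  assert (HF2 : forall z, Cmod z < 1 -> cderiv F2 z (F3 z)).
  { intros z Hz. apply cderiv_CPSeries; [|exact Hz]. now do 2 apply subgeometric_PS_Cderive. }
  assert (HF0 : F 0%C = 1%C).
  { unfold F. rewrite CPSeries_at_0 by exact Hh. unfold h, hyp_coef. simpl. field. }
  assert (Hode : forall z, Cmod z < 1 ->
            (z * (1 - z) * F2 z + (a + b + 1) * (1 - z) * F1 z = a * b * F z)%C).
  { intros z Hz. assert (H := hypergeometric_equation a b (a + b + 1) z Hc Hz).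
    change (z * (1 - z) * F2 z + (a + b + 1 - (a + b + 1) * z) * F1 z = a * b * F z)%C in H.
    rewrite <- H. ring. }
  set (kap := (1 - alpha) * cos lam).
  assert (Hkap : 0 < kap) by (unfold kap; nra).
  set (k := ((2 * kap)%R * expi lam)%C).
  assert (Hk : k <> 0%C).
  { intros H. assert (H1 := f_equal Re H). unfold k in H1. rewrite re_scal_l in H1.
    simpl in H1. nra. }
  assert (H10 : RtoC 1 <> 0%C) by (apply RtoC_neq_0; lra).
  assert (HF0' : F 0%C <> 0%C) by (rewrite HF0; exact H10).
  assert (Hdom : forall z, Cmod z < 1 -> Cmod (z * F1 z)%C < Cmod (k * F z + z * F1 z)%C).
  { destruct (first_boundary_contact F F1 F2 F3 k HF HF1 HF2 Hk HF0'
                (ode_no_common_zero F F1 F2 _ _ HF HF1 Hode HF0'))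
      as [H|[z [m [Hz [Hm [HQ [HAQ HE]]]]]]]; [exact H|exfalso].
    apply (boundary_contact_impossible lam alpha m a b z (F z) (z * F1 z)%C
             (z * F1 z + z * z * F2 z)%C Hcos (proj2 halpha) HW HL HN HLN Hz Hm HQ HAQ HE).
    rewrite <- (Hode z Hz). ring. }
  assert (HFn : forall z, Cmod z < 1 -> F z <> 0%C).
  { intros z Hz H. specialize (Hdom z Hz). rewrite H in Hdom.
    replace (k * 0 + z * F1 z)%C with (z * F1 z)%C in Hdom by ring. lra. }
  assert (Hf : forall z, Cmod z < 1 -> cderiv (fun z => z * F z)%C z (F z + z * F1 z)%C).
  { intros z Hz. refine (cderiv_ext _ _ _ _ _ (fun x => eq_refl) _
      (cderiv_mult _ _ _ _ _ (cderiv_id z) (HF z Hz))). ring. }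
  split; [|split; [|split; [|split]]].
  - intros z Hz. eexists. apply (Hf z Hz).
  - ring.
  - rewrite (is_C_derive_unique _ _ _ (Hf 0%C ltac:(rewrite Cmod_0; lra))), HF0. ring.
  - intros z Hz Hz0. apply Cmult_neq_0; [exact Hz0 | now apply HFn].
  - intros z Hz. fold u. unfold zlogderiv. destruct (Ceq_dec z 0) as [Hz0|Hz0].
    + rewrite Cmult_1_r. unfold u, expi. simpl. rewrite cos_neg. nra.
    + rewrite (is_C_derive_unique _ _ _ (Hf z Hz)).
      assert (HFz := HFn z Hz).
      (* q lies in the half-plane: |q| < |q + k| unfolds to Re (u q) > - kap *)
      set (q := (z * F1 z / F z)%C).
      replace (u * (z * (F z + z * F1 z) / (z * F z)))%C with (u + u * q)%C
        by (unfold q; field; now split).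
      assert (HFm : 0 < Cmod (F z)) by now apply Cmod_gt_0.
      assert (Hq : Cmod q < Cmod (q + k)%C).
      { apply Rmult_lt_reg_l with (Cmod (F z)); [exact HFm|].
        rewrite <- !Cmod_mult.
        replace (F z * q)%C with (z * F1 z)%C by (unfold q; field; exact HFz).
        replace (F z * (q + k))%C with (k * F z + z * F1 z)%C by (unfold q; field; exact HFz).
        now apply Hdom. }
      assert (Hqk := Cmod2_plus q k).
      assert (Hconj : (q * Cconj k = (2 * kap)%R * (u * q))%C).
      { unfold k. rewrite Cmult_conj, Cconj_expi. fold u.
        replace (Cconj (2 * kap)%R) with (RtoC (2 * kap)).
        - ring.
        - unfold Cconj, RtoC. simpl. f_equal. ring. }
      assert (Hkm : Cmod k ^ 2 = (2 * kap) ^ 2).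
      { rewrite Cmod2_alt. unfold k, expi.
        assert (H := sin2_cos2 lam). unfold Rsqr in H.
        transitivity ((2 * kap) ^ 2 * (sin lam * sin lam + cos lam * cos lam));
          [simpl; ring | rewrite H; ring]. }
      rewrite Hconj, re_scal_l, Hkm in Hqk.
      assert (Hq0 := Cmod_ge_0 q).
      assert (Hre : - kap < Re (u * q)).
      { assert (H : 0 < 4 * kap * (Re (u * q) + kap)) by nra. nra. }
      rewrite re_plus. assert (Hu : Re u = cos lam).
      { unfold u, expi. simpl. apply cos_neg. }
      unfold kap in Hre. lra.
Qed.
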